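(* Assume the setting below, on the A-mesh $S_{1/\varepsilon}$ (i.e. $\lambda=\varepsilon^{-1}$) with mesh parameter $a>3$. There exist $N_0$ and $C$, both independent of $\varepsilon$, such that for all $N\ge N_0$, \[ \|w^N-W^N\|\le C\max\left\{\varepsilon|\ln\varepsilon|^3N^{-2},\ \varepsilon N^{-1}\right\}. \]
   Context: Let $0<\varepsilon<1$. Let $b,c,f\in C^4[0,1]$, and let $\beta$ be a constant with $b(x)>\beta>0$ and $c(x)\ge0$ on $[0,1]$. Let $u$ be the solution of $-\varepsilon u''-bu'+cu=f$ on $(0,1)$ with $u(0)=u(1)=0$. Let $u_0$ be the solution of $-bu_0'+cu_0=f$ on $(0,1)$ with $u_0(1)=0$. Set $w=u-u_0$. Mesh $S_\lambda$, $\lambda\in\{N,\varepsilon^{-1}\}$. $N$ is a positive integer. $Q\in(0,1)$ is a fixed rational with $J=QN$ an integer, and $a>0$. Set $\xi=(a\varepsilon/\beta)\ln\lambda$, assumed $\le Q$, and $h=\xi/J$, $H=(1-\xi)/(N-J)$. The mesh points are $x_i=ih$ ($0\le i\le J$) and $x_i=\xi+(i-J)H$ ($J\le i\le N$). Write $h_i=x_i-x_{i-1}$ and $\hbar_i=(h_i+h_{i+1})/2$. Scheme. $D^+U_i=(U_{i+1}-U_i)/h_{i+1}$, $D^-U_i=(U_i-U_{i-1})/h_i$, $D''U_i=(D^+U_i-D^-U_i)/\hbar_i$. Let $\sigma(\rho)=2\rho/(e^{2\rho}-1)$ for $\rho>0$, $\sigma(0)=1$, and $\rho_i=b(x_i)h_{i+1}/(2\varepsilon)$.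 The ASI operator is $L^NU_i=-\varepsilon\sigma(\rho_i)D''U_i-b(x_i)D^+U_i+c(x_i)U_i$. $W^N$ solves $W^N_0=-u_0(0)$, $L^NW^N_i=\varepsilon u_0''(x_i)$ for $1\le i\le N-1$, $W^N_N=0$. $w^N$ is the restriction of $w$ to the mesh, and $\|U\|=\max_i|U_i|$. *)

(* Defs.v *)
From Stdlib Require Import Reals Lra Lia.
From Coquelicot Require Import Coquelicot.
Open Scope R_scope.

Definition C4_01 (g : R -> R) : Prop :=
  forall x, 0 <= x <= 1 ->
    (forall k, (k <= 4)%nat -> ex_derive_n g k x) /\ continuous (Derive_n g 4) x.

Definition cont01 (g : R -> R) : Prop :=
  forall x, 0 <= x <= 1 ->
    filterlim g (within (fun y => 0 <= y <= 1) (locally x)) (locally (g x)).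

Definition is_sol_u (eps : R) (b c f u : R -> R) : Prop :=
  cont01 u /\ u 0 = 0 /\ u 1 = 0 /\
  forall x, 0 < x < 1 ->
    ex_derive u x /\ ex_derive (Derive u) x /\
    - eps * Derive (Derive u) x - b x * Derive u x + c x * u x = f x.

Definition is_sol_u0 (b c f u0 : R -> R) : Prop :=
  cont01 u0 /\ u0 1 = 0 /\
  forall x, 0 < x < 1 ->
    ex_derive u0 x /\ - b x * Derive u0 x + c x * u0 x = f x.

Definition xi_tr (a eps beta lam : R) : R := a * eps / beta * ln lam.

Definition mesh_pt (N J : nat) (xi : R) (i : nat) : R :=
  if (i <=? J)%nat then INR i * (xi / INR J)
  else xi + INR (i - J) * ((1 - xi) / INR (N - J)).

Definition sigma (rho : R) : R :=
  if Rlt_dec 0 rho then 2 * rho / (exp (2 * rho) - 1) else 1.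

Definition LN (eps : R) (b c : R -> R) (x : nat -> R) (U : nat -> R) (i : nat) : R :=
  let hi  := x i - x (i - 1)%nat in
  let hi1 := x (i + 1)%nat - x i in
  let hb  := (hi + hi1) / 2 in
  let Dp  := (U (i + 1)%nat - U i) / hi1 in
  let Dm  := (U i - U (i - 1)%nat) / hi in
  let rho := b (x i) * hi1 / (2 * eps) in
  - eps * sigma rho * ((Dp - Dm) / hb) - b (x i) * Dp + c (x i) * U i.

Definition is_disc_sol (eps : R) (b c u0 : R -> R) (N : nat) (x : nat -> R)
  (W : nat -> R) : Prop :=
  W 0%nat = - u0 0 /\ W N = 0 /\
  forall i, (1 <= i)%nat -> (i <= N - 1)%nat ->
    LN eps b c x W i = eps * Derive (Derive u0) (x i).

(* Main.v *)
(** With [w = u - u0] and [E x = exp (- beta x / eps)], the continuous problem gives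
    [|w| <= K (eps + E)], [|w'| <= K (eps + E / eps)] and
    [|w''| <= K (1 + E / eps^2)].  On a uniform stencil the ASI operator is exact for the
    operator with coefficient frozen at the midpoint, and it is monotone, so its value at [w]
    lies between the extreme values of [G = - eps w'' - b(x_i) w'], where
    [G = eps u0'' - c w + (b - b(x_i)) w'].  No derivative of [w] beyond the
    second is therefore needed: a first-order expansion of [G] suffices on the fine mesh, where
    the first moment of the stencil is [O(h^2 / eps)], and the oscillation of [G] suffices
    on the coarse mesh, where [E <= eps^2].  The scheme is stable from the weighted l^1 norm to the
    maximum norm, and summing the truncation errors over the layer gives
    [h^2 / eps^2 * (h + eps)], that is [eps L^3 / N^3 + eps L^2 / N^2] with [L = |ln eps|]. *)

From Stdlib Require Import Reals Lra Lia.
From Coquelicot Require Import Coquelicot.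
Require Import Defs.
Open Scope R_scope.

(** In the layer the truncation error is of order [h^2 / eps^2], that is [L^2 / N^2], at each node.
    A stability estimate in the maximum norm would return just that; weighting each node by its step
    length gains the missing factor [eps], the width of the layer. The weighted sum is never formed:
    the errors are majorized by the increments of a function [S'], so that the exponentials
    telescope. Three sources produce [eps / N]: the variation of [eps u0''] on every stencil, the
    oscillation of the rest of [G] on the coarse mesh, and the one non-uniform stencil. The term
    [eps L^2 / N^2] is neither of the two in the maximum; for [L >= 1] it is below the cubic one,
    for [L < 1] below [eps / N]. The solutions are differentiable only inside the interval and
    merely continuous up to its ends. The bound for [w'] is therefore started from interior
    points. *)

(** * Inequalities for the exponential and for the fitting factor [sigma] *)

Lemma mvt_open (f f' : R -> R) (a b : R) :
  a < b ->
  (forall x, a <= x <= b -> continuity_pt f x) ->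
  (forall x, a < x < b -> is_derive f x (f' x)) ->
  exists c, a < c < b /\ f b - f a = f' c * (b - a).
Proof.
intros Hab Hc Hd.
assert (pr : forall c, a < c < b -> derivable_pt f c).
{ intros c Hcab. exists (f' c). now apply is_derive_Reals, Hd. }
destruct (MVT f id a b pr (fun c _ => derivable_pt_id c) Hab Hc
  (fun c _ => derivable_continuous_pt _ _ (derivable_pt_id c))) as [c [P E]].
exists c; split; [exact P|].
rewrite (derive_pt_eq_0 f c (f' c)) in E by now apply is_derive_Reals, Hd.
rewrite (derive_pt_eq_0 id c 1) in E by apply derivable_pt_lim_id.
unfold id in E; lra.
Qed.

Lemma is_derive_continuity_pt (f : R -> R) (x l : R) :
  is_derive f x l -> continuity_pt f x.
Proof.
intros H. apply continuity_pt_filterlim, (ex_derive_continuous f). now exists l.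
Qed.

Lemma nondecreasing_of_derive_nonneg (f f' : R -> R) (a b : R) :
  a <= b ->
  (forall x, a <= x <= b -> continuity_pt f x) ->
  (forall x, a < x < b -> is_derive f x (f' x)) ->
  (forall x, a < x < b -> 0 <= f' x) ->
  f a <= f b.
Proof.
intros [Hab| ->] Hc Hd Hp; [|lra].
destruct (mvt_open f f' a b Hab Hc Hd) as [c [Hcab E]].
specialize (Hp c Hcab). nra.
Qed.

Lemma exp_second_order (t : R) : 0 <= t -> 1 + t + t * t / 2 <= exp t.
Proof.
intros Ht.
pose (f := fun s => exp s - 1 - s - s * s / 2).
assert (f 0 <= f t).
{ apply (nondecreasing_of_derive_nonneg f (fun s => exp s - 1 - s)); [exact Ht| | |].
  - intros x _. apply (is_derive_continuity_pt _ _ (exp x - 1 - x)).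
    unfold f; auto_derive; [easy|field].
  - intros x _. unfold f; auto_derive; [easy|field].
  - intros x _. pose proof (exp_ineq1_le x); lra. }
unfold f in H. rewrite exp_0 in H. lra.
Qed.

(** The trapezoidal rule overestimates the integral of the convex function [exp] over [[0, t]]. *)
Lemma exp_trapezoid (t : R) : 0 <= t -> exp t - 1 <= t / 2 * (exp t + 1).
Proof.
intros Ht.
pose (f := fun s => s / 2 * (exp s + 1) - exp s + 1).
assert (f 0 <= f t).
{ apply (nondecreasing_of_derive_nonneg f (fun s => (1 + s * exp s - exp s) / 2)); [exact Ht| | |].
  - intros x _. apply (is_derive_continuity_pt _ _ ((1 + x * exp x - exp x) / 2)).
    unfold f; auto_derive; [easy|field].
  - intros x _. unfold f; auto_derive; [easy|field].
  - intros x _. pose proof (exp_ineq1_le (- x)). pose proof (exp_pos x).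
    assert (exp (- x) * exp x = 1) by (rewrite <- exp_plus, Rplus_opp_l; apply exp_0).
    nra. }
unfold f in H. rewrite exp_0 in H. lra.
Qed.

Lemma exp_minus_1_pos (t : R) : 0 < t -> 0 < exp t - 1.
Proof. intros Ht; pose proof (exp_ineq1 t); lra. Qed.

Lemma sigma_pos_eq (rho : R) : 0 < rho -> sigma rho * (exp (2 * rho) - 1) = 2 * rho.
Proof.
intros H; unfold sigma; destruct (Rlt_dec 0 rho); [|lra].
pose proof (exp_minus_1_pos (2 * rho)); field; lra.
Qed.

Lemma sigma_bounds (rho : R) : 0 < rho -> 0 < sigma rho <= 1.
Proof.
intros H. pose proof (sigma_pos_eq rho H). pose proof (exp_ineq1_le (2 * rho)).
split; nra.
Qed.

(** Since [sigma rho + rho] is [rho coth rho], this is a bound for [rho coth rho - 1]. Up to the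
    factor [eps / b0] that quantity is the first moment of the stencil, which decides the order of
    the scheme on the fine mesh. *)
Lemma sigma_deviation (rho : R) : 0 < rho -> 0 <= sigma rho + rho - 1 <= rho * rho.
Proof.
intros H. pose proof (sigma_pos_eq rho H) as E.
pose proof (sigma_bounds rho H).
pose proof (exp_second_order (2 * rho) ltac:(lra)).
pose proof (exp_trapezoid (2 * rho) ltac:(lra)).
set (m := exp (2 * rho) - 1) in *.
assert (Hm : 2 * rho + 2 * rho * rho <= m) by (unfold m; lra).
assert (Hm2 : m <= rho * (m + 2)) by (unfold m in *; lra).
split.
- apply Rnot_lt_le; intros Hn. nra.
- assert (sigma rho * (1 + rho) <= 1).
  { apply Rmult_le_reg_r with (2 * rho); [lra|]. rewrite <- E at 2. nra. }
  nra.
Qed.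

(** [sigma] is decreasing with bounded slope. The one-sided form is what stability asks for, since
    only growth of [sigma] from node to node does harm. Multiplied by both denominators, each case
    reduces to [1 + t <= exp t]; the price is the factor 2, where 1 would be sharp. *)
Lemma sigma_increment (r s : R) : 0 < r -> 0 < s ->
  sigma r - sigma s <= Rmax 0 (2 * (s - r)).
Proof.
intros Hr Hs.
pose proof (sigma_pos_eq r Hr) as Er. pose proof (sigma_pos_eq s Hs) as Es.
pose proof (sigma_bounds r Hr). pose proof (sigma_bounds s Hs).
pose proof (exp_minus_1_pos (2 * r) ltac:(lra)) as Pr.
pose proof (exp_minus_1_pos (2 * s) ltac:(lra)) as Ps.
assert (Hprod : (sigma r - sigma s) * ((exp (2 * r) - 1) * (exp (2 * s) - 1))
   = 2 * r * (exp (2 * s) - 1) - 2 * s * (exp (2 * r) - 1)).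
{ replace ((sigma r - sigma s) * ((exp (2 * r) - 1) * (exp (2 * s) - 1)))
   with ((sigma r * (exp (2 * r) - 1)) * (exp (2 * s) - 1)
     - (sigma s * (exp (2 * s) - 1)) * (exp (2 * r) - 1)) by ring.
  rewrite Er, Es; ring. }
destruct (Rle_dec r s) as [H1|H1].
- apply Rle_trans with (2 * (s - r)); [|apply Rmax_r].
  apply Rmult_le_reg_r with ((exp (2 * r) - 1) * (exp (2 * s) - 1)).
  { now apply Rmult_lt_0_compat. }
  rewrite Hprod.
  pose proof (exp_ineq1_le (2 * r)).
  pose proof (exp_ineq1_le (- (2 * (s - r)))).
  assert (Hm : exp (2 * r) = exp (2 * s) * exp (- (2 * (s - r)))).
  { rewrite <- exp_plus; f_equal; ring. }
  set (A := exp (2 * r)) in *. set (B := exp (2 * s)) in *.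
  assert (HAB : B * (1 - 2 * (s - r)) <= A) by (rewrite Hm; nra).
  assert (0 <= B * ((A - 1 - 2 * r) * (s - r))).
  { apply Rmult_le_pos; [|apply Rmult_le_pos]; lra. }
  assert (2 * r * (B - A) <= 2 * r * (B * (2 * (s - r)))) by (apply Rmult_le_compat_l; lra).
  lra.
- apply Rle_trans with 0; [|apply Rmax_l].
  apply Rmult_le_reg_r with ((exp (2 * r) - 1) * (exp (2 * s) - 1)).
  { now apply Rmult_lt_0_compat. }
  rewrite Hprod, Rmult_0_l.
  pose proof (exp_ineq1_le (2 * (r - s))).
  pose proof (exp_ineq1_le (- (2 * s))).
  assert (Hm : exp (2 * r) = exp (2 * s) * exp (2 * (r - s))).
  { rewrite <- exp_plus; f_equal; ring. }
  assert (Hi : exp (- (2 * s)) * exp (2 * s) = 1).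
  { rewrite <- exp_plus, Rplus_opp_l; apply exp_0. }
  set (A := exp (2 * r)) in *. set (B := exp (2 * s)) in *.
  assert (HAB : B * (1 + 2 * (r - s)) <= A) by (rewrite Hm; nra).
  assert (B - 1 <= 2 * s * B) by nra.
  assert (0 <= (2 * s * B - (B - 1)) * (r - s)) by nra.
  nra.
Qed.

(** * Consistency of the stencil with frozen coefficient *)

Definition asi_stencil (eps b0 h ym y0 yp : R) : R :=
  - eps * sigma (b0 * h / (2 * eps)) * (((yp - y0) / h - (y0 - ym) / h) / h)
  - b0 * ((yp - y0) / h).

(* As [y' e^(b0 z/eps)] is nonincreasing, [y] lies below the function [A + B e^(-b0 z/eps)]
   tangent to it at the midpoint, and the stencil annihilates such functions. *)
Lemma asi_stencil_nonneg (eps b0 h x : R) (y y1 y2 : R -> R) :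
  0 < eps -> 0 < b0 -> 0 < h ->
  (forall z, x - h <= z <= x + h -> continuity_pt y z) ->
  (forall z, x - h < z < x + h -> is_derive y z (y1 z)) ->
  (forall z, x - h < z < x + h -> is_derive y1 z (y2 z)) ->
  (forall z, x - h < z < x + h -> 0 <= - eps * y2 z - b0 * y1 z) ->
  0 <= asi_stencil eps b0 h (y (x - h)) (y x) (y (x + h)).
Proof.
intros He Hb Hh Hc H1 H2 HG.
set (r := b0 / eps).
assert (Hr : 0 < r) by (apply Rdiv_lt_0_compat; lra).
assert (Heb : b0 = r * eps) by (unfold r; field; lra).
pose (k := fun z => - (y1 z * exp (r * (z - x)))).
pose (k' := fun z => - (y2 z * exp (r * (z - x)) + y1 z * (r * exp (r * (z - x))))).
assert (Hk : forall z, x - h < z < x + h -> is_derive k z (k' z)).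
{ intros z Hz. unfold k, k'. pose proof (H2 z Hz) as D2.
  auto_derive; [now exists (y2 z)|].
  rewrite (is_derive_unique (fun t : R => y1 t) _ _ D2). unfold Rminus; ring. }
assert (Hk0 : forall z, x - h < z < x + h -> 0 <= k' z).
{ intros z Hz. specialize (HG z Hz). unfold k'.
  pose proof (exp_pos (r * (z - x))).
  assert (0 <= - (y2 z + r * y1 z)).
  { apply Rmult_le_reg_l with eps; [lra|]. rewrite Heb in HG. nra. }
  nra. }
assert (Hmono : forall s t, x - h < s -> s <= t -> t < x + h -> k s <= k t).
{ intros s t Hs Hst Ht.
  apply (nondecreasing_of_derive_nonneg k k'); try lra.
  - intros z Hz. apply (is_derive_continuity_pt _ _ (k' z)), Hk; lra.
  - intros z Hz; apply Hk; lra.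
  - intros z Hz; apply Hk0; lra. }
(* Up to a constant, [v] is [y] minus its tangent exponential. By [Hkv], the sign of [v'] is that of
   [k x - k z], so [v] rises up to the midpoint and falls after it. *)
pose (v := fun z => y z + y1 x / r * exp (- r * (z - x))).
pose (v' := fun z => y1 z - y1 x * exp (- r * (z - x))).
assert (Hv : forall z, x - h < z < x + h -> is_derive v z (v' z)).
{ intros z Hz. unfold v, v'. pose proof (H1 z Hz) as D1.
  auto_derive; [now exists (y1 z)|].
  rewrite (is_derive_unique (fun t : R => y t) _ _ D1). unfold Rminus; field. lra. }
assert (Hvc : forall z, x - h <= z <= x + h -> continuity_pt v z).
{ intros z Hz. apply continuity_pt_plus; [now apply Hc|].
  apply (is_derive_continuity_pt (fun z => y1 x / r * exp (- r * (z - x))) z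
     (y1 x / r * (- r * exp (- r * (z - x))))).
  auto_derive; [easy|unfold Rminus; ring]. }
assert (Hkv : forall z, v' z = (k x - k z) * exp (- r * (z - x))).
{ intros z. unfold v', k.
  replace (r * (x - x)) with 0 by ring. rewrite exp_0.
  transitivity (y1 z * (exp (r * (z - x)) * exp (- r * (z - x))) - y1 x * exp (- r * (z - x))); [|ring].
  rewrite <- exp_plus. replace (r * (z - x) + - r * (z - x)) with 0 by ring.
  rewrite exp_0. ring. }
assert (HL : v (x - h) <= v x).
{ apply (nondecreasing_of_derive_nonneg v v'); try lra.
  - intros z Hz; apply Hvc; lra.
  - intros z Hz; apply Hv; lra.
  - intros z Hz. rewrite Hkv. pose proof (Hmono z x ltac:(lra) ltac:(lra) ltac:(lra)).
    pose proof (exp_pos (- r * (z - x))). nra. }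
assert (HR : - v x <= - v (x + h)).
{ apply (nondecreasing_of_derive_nonneg (fun z => - v z) (fun z => - v' z)); try lra.
  - intros z Hz; apply continuity_pt_opp, Hvc; lra.
  - intros z Hz. apply (is_derive_opp v), Hv; lra.
  - intros z Hz. rewrite Hkv. pose proof (Hmono x z ltac:(lra) ltac:(lra) ltac:(lra)).
    pose proof (exp_pos (- r * (z - x))). nra. }
set (s := sigma (b0 * h / (2 * eps))).
assert (Hrho : b0 * h / (2 * eps) = r * h / 2) by (rewrite Heb; field; lra).
assert (Hs : s * (exp (r * h) - 1) = r * h).
{ unfold s. rewrite Hrho.
  replace (r * h) with (2 * (r * h / 2)) at 2 3 by field.
  apply sigma_pos_eq. nra. }
assert (Hs0 : 0 < s).
{ unfold s. rewrite Hrho. apply sigma_bounds. nra. }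
assert (Hexp : asi_stencil eps b0 h (v (x - h)) (v x) (v (x + h))
  = asi_stencil eps b0 h (y (x - h)) (y x) (y (x + h))).
{ unfold asi_stencil, v. fold s.
  replace (- r * (x - h - x)) with (r * h) by ring.
  replace (- r * (x + h - x)) with (- (r * h)) by ring.
  replace (- r * (x - x)) with 0 by ring.
  rewrite exp_0, exp_Ropp, Heb.
  pose proof (exp_pos (r * h)). pose proof (exp_minus_1_pos (r * h) ltac:(nra)).
  replace s with (r * h / (exp (r * h) - 1))
    by (apply Rmult_eq_reg_r with (exp (r * h) - 1); [rewrite Hs; field|]; lra).
  field. repeat split; lra. }
rewrite <- Hexp. unfold asi_stencil. fold s.
assert (Hh' : 0 < / h) by now apply Rinv_0_lt_compat.
(* In this arrangement the stencil is a combination, with nonnegative weights, of the two drops of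
   [v] away from the midpoint. *)
replace (- eps * s * (((v (x + h) - v x) / h - (v x - v (x - h)) / h) / h)
   - b0 * ((v (x + h) - v x) / h))
  with ((eps * s * / h * / h + b0 * / h) * (v x - v (x + h)) + eps * s * / h * / h * (v x - v (x - h)))
  by (field; lra).
assert (0 <= eps * s * / h * / h) by (repeat apply Rmult_le_pos; lra).
assert (0 <= b0 * / h) by (apply Rmult_le_pos; lra).
nra.
Qed.

(** The linear part [gam * (z - x)] is charged with the first moment of the stencil only, at most
    [b0 h^2 / (4 eps)], and not with [h]. On a mesh that resolves the layer this is the gain of one
    order. *)
Lemma asi_stencil_lower (eps b0 h x g gam del : R) (y y1 y2 : R -> R) :
  0 < eps -> 0 < b0 -> 0 < h ->
  (forall z, x - h <= z <= x + h -> continuity_pt y z) ->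
  (forall z, x - h < z < x + h -> is_derive y z (y1 z)) ->
  (forall z, x - h < z < x + h -> is_derive y1 z (y2 z)) ->
  (forall z, x - h < z < x + h ->
     g + gam * (z - x) - del <= - eps * y2 z - b0 * y1 z) ->
  g - (del + Rabs gam * (b0 * (h * h) / (4 * eps)))
    <= asi_stencil eps b0 h (y (x - h)) (y x) (y (x + h)).
Proof.
intros He Hb Hh Hc H1 H2 HG.
(* [q] is the quadratic with [q x = 0] and [- eps q'' - b0 q' = - (g + gam (z - x) - del)]. Thus
   [y + q] satisfies the hypothesis of [asi_stencil_nonneg], and the value of the stencil at [q] is
   explicit. *)
pose (q := fun z => (g - del) / b0 * (z - x)
   + gam * ((z - x) * (z - x) / (2 * b0) - eps / (b0 * b0) * (z - x))).
assert (Hq : forall z, is_derive q z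
   ((g - del) / b0 + gam * ((z - x) / b0 - eps / (b0 * b0)))).
{ intros z. unfold q. auto_derive; [easy|]. field. lra. }
assert (N : 0 <= asi_stencil eps b0 h (y (x - h) + q (x - h)) (y x + q x) (y (x + h) + q (x + h))).
{ apply (asi_stencil_nonneg eps b0 h x (fun z => y z + q z)
   (fun z => y1 z + ((g - del) / b0 + gam * ((z - x) / b0 - eps / (b0 * b0))))
   (fun z => y2 z + gam / b0)); try easy.
  - intros z Hz. apply continuity_pt_plus; [now apply Hc|].
    now apply is_derive_continuity_pt with (1 := Hq z).
  - intros z Hz. apply (is_derive_plus y q); [now apply H1|apply Hq].
  - intros z Hz. pose proof (H2 z Hz) as D. auto_derive; [now exists (y2 z)|].
    rewrite (is_derive_unique (fun t : R => y1 t) _ _ D). field; lra.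
  - intros z Hz. specialize (HG z Hz).
    replace (- eps * (y2 z + gam / b0) -
      b0 * (y1 z + ((g - del) / b0 + gam * ((z - x) / b0 - eps / (b0 * b0)))))
      with (- eps * y2 z - b0 * y1 z - (g + gam * (z - x) - del)) by (field; lra).
    lra. }
set (rho := b0 * h / (2 * eps)) in *.
assert (Hrho : 0 < rho) by (unfold rho; apply Rdiv_lt_0_compat; nra).
pose proof (sigma_deviation rho Hrho) as Hm.
assert (E : asi_stencil eps b0 h (y (x - h) + q (x - h)) (y x + q x) (y (x + h) + q (x + h))
  = asi_stencil eps b0 h (y (x - h)) (y x) (y (x + h)) - (g - del)
    - gam * (eps / b0 * (sigma rho + rho - 1))).
{ unfold asi_stencil, q. fold rho. unfold rho at 4. field. lra. }
rewrite E in N.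
assert (Hm1 : 0 <= eps / b0 * (sigma rho + rho - 1) <= b0 * (h * h) / (4 * eps)).
{ assert (0 < eps / b0) by (apply Rdiv_lt_0_compat; lra).
  split; [nra|].
  replace (b0 * (h * h) / (4 * eps)) with (eps / b0 * (rho * rho)) by (unfold rho; field; lra).
  nra. }
pose proof (Rle_abs (- gam)). rewrite Rabs_Ropp in H.
pose proof (Rabs_pos gam).
nra.
Qed.

Lemma asi_stencil_consistency (eps b0 h x g gam del : R) (y y1 y2 : R -> R) :
  0 < eps -> 0 < b0 -> 0 < h ->
  (forall z, x - h <= z <= x + h -> continuity_pt y z) ->
  (forall z, x - h < z < x + h -> is_derive y z (y1 z)) ->
  (forall z, x - h < z < x + h -> is_derive y1 z (y2 z)) ->
  (forall z, x - h < z < x + h ->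
     Rabs (- eps * y2 z - b0 * y1 z - g - gam * (z - x)) <= del) ->
  Rabs (asi_stencil eps b0 h (y (x - h)) (y x) (y (x + h)) - g)
    <= del + Rabs gam * (b0 * (h * h) / (4 * eps)).
Proof.
intros He Hb Hh Hc H1 H2 HG.
assert (L := asi_stencil_lower eps b0 h x g gam del y y1 y2 He Hb Hh Hc H1 H2).
assert (U := asi_stencil_lower eps b0 h x (- g) (- gam) del
  (fun z => - y z) (fun z => - y1 z) (fun z => - y2 z) He Hb Hh).
apply Rabs_le; split.
- enough (g - (del + Rabs gam * (b0 * (h * h) / (4 * eps)))
    <= asi_stencil eps b0 h (y (x - h)) (y x) (y (x + h))) by lra.
  apply L. intros z Hz. pose proof (HG z Hz) as B. apply Rabs_le_between in B. lra.
- rewrite Rabs_Ropp in U.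
  enough (- g - (del + Rabs gam * (b0 * (h * h) / (4 * eps)))
    <= asi_stencil eps b0 h (- y (x - h)) (- y x) (- y (x + h))).
  { unfold asi_stencil in *. lra. }
  apply U.
  + intros z Hz; apply continuity_pt_opp; auto.
  + intros z Hz; apply (is_derive_opp y); auto.
  + intros z Hz; apply (is_derive_opp y1); auto.
  + intros z Hz. pose proof (HG z Hz) as B. apply Rabs_le_between in B. lra.
Qed.

Lemma exp_nondecreasing (x y : R) : x <= y -> exp x <= exp y.
Proof. intros [H| ->]; [left; now apply exp_increasing|lra]. Qed.

(** * Discrete maximum principle and stability from the weighted l^1 norm *)

Lemma LN_S (eps : R) (b c : R -> R) (x U : nat -> R) (n : nat) :
  LN eps b c x U (S n) =
  - eps * sigma (b (x (S n)) * (x (S (S n)) - x (S n)) / (2 * eps))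
    * (((U (S (S n)) - U (S n)) / (x (S (S n)) - x (S n))
        - (U (S n) - U n) / (x (S n) - x n))
       / ((x (S n) - x n + (x (S (S n)) - x (S n))) / 2))
  - b (x (S n)) * ((U (S (S n)) - U (S n)) / (x (S (S n)) - x (S n)))
  + c (x (S n)) * U (S n).
Proof. unfold LN. rewrite Nat.add_1_r. simpl Nat.sub. now rewrite Nat.sub_0_r. Qed.

Lemma LN_minus (eps : R) (b c : R -> R) (x U V : nat -> R) (n : nat) :
  LN eps b c x (fun i => U i - V i) n = LN eps b c x U n - LN eps b c x V n.
Proof. unfold LN, Rdiv. ring. Qed.

Lemma LN_plus (eps : R) (b c : R -> R) (x U V : nat -> R) (n : nat) :
  LN eps b c x (fun i => U i + V i) n = LN eps b c x U n + LN eps b c x V n.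
Proof. unfold LN, Rdiv. ring. Qed.

(** At a leftmost minimizer in the interior the backward difference is strictly negative and the
    forward one nonnegative. This is why the discrete maximum principle holds with a non-strict
    inequality for [LN]. *)
Lemma leftmost_min (U : nat -> R) (N : nat) :
  exists i, (i <= N)%nat /\ (forall j, (j <= N)%nat -> U i <= U j)
    /\ (forall j, (j < i)%nat -> U i < U j).
Proof.
induction N as [|N [i [Hi [Hmin Hleft]]]].
- exists 0%nat. split; [lia|split].
  + intros j Hj. replace j with 0%nat by lia. lra.
  + intros j Hj; lia.
- destruct (Rle_dec (U i) (U (S N))) as [H|H].
  + exists i. split; [lia|split; [|exact Hleft]].
    intros j Hj. destruct (Nat.eq_dec j (S N)) as [->|]; [exact H|apply Hmin; lia].
  + exists (S N). split; [lia|split].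
    * intros j Hj. destruct (Nat.eq_dec j (S N)) as [->|]; [lra|].
      specialize (Hmin j ltac:(lia)); lra.
    * intros j Hj. specialize (Hmin j ltac:(lia)); lra.
Qed.

Lemma discrete_maximum_principle (eps : R) (b c : R -> R) (x U : nat -> R) (N : nat) :
  0 < eps ->
  (forall i, (i < N)%nat -> x i < x (S i)) ->
  (forall i, (i <= N)%nat -> 0 < b (x i)) ->
  (forall i, (i <= N)%nat -> 0 <= c (x i)) ->
  0 <= U 0%nat -> 0 <= U N ->
  (forall n, (S n < N)%nat -> 0 <= LN eps b c x U (S n)) ->
  forall i, (i <= N)%nat -> 0 <= U i.
Proof.
intros He Hx Hb Hc H0 HN HL.
destruct (leftmost_min U N) as [m [Hm [Hmin Hleft]]].
destruct (Rle_dec 0 (U m)) as [Hp|Hn].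
{ intros i Hi. specialize (Hmin i Hi). lra. }
exfalso.
destruct m as [|n]; [lra|].
destruct (Nat.eq_dec (S n) N) as [E|NE]; [rewrite E in Hn; lra|].
specialize (HL n ltac:(lia)). rewrite LN_S in HL.
pose proof (Hleft n ltac:(lia)) as L1.
pose proof (Hmin (S (S n)) ltac:(lia)) as L2.
pose proof (Hx n ltac:(lia)) as X1. pose proof (Hx (S n) ltac:(lia)) as X2.
pose proof (Hb (S n) Hm) as B. pose proof (Hc (S n) Hm) as C.
set (s := sigma _) in HL.
assert (Hs : 0 < s).
{ apply sigma_bounds. apply Rdiv_lt_0_compat; [apply Rmult_lt_0_compat|]; lra. }
set (h1 := x (S n) - x n) in *. set (h2 := x (S (S n)) - x (S n)) in *.
assert (P1 : 0 < h1) by (unfold h1; lra). assert (P2 : 0 < h2) by (unfold h2; lra).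
assert (D1 : 0 <= (U (S (S n)) - U (S n)) / h2).
{ apply Rdiv_le_0_compat; lra. }
assert (D2 : 0 < - ((U (S n) - U n) / h1)).
{ replace (- ((U (S n) - U n) / h1)) with ((U n - U (S n)) / h1) by (field; lra).
  apply Rdiv_lt_0_compat; lra. }
assert (D3 : 0 < eps * s * (((U (S (S n)) - U (S n)) / h2 - (U (S n) - U n) / h1) / ((h1 + h2) / 2))).
{ apply Rmult_lt_0_compat; [nra|]. apply Rdiv_lt_0_compat; lra. }
nra.
Qed.

(* The barrier is [Y i = sum over j >= i of (x (S j) - x j) * P j], where [P]
   solves the first-order recursion that the scheme without its [c] term
   imposes on minus the forward difference quotient.  Summing that recursion by parts
   bounds [Y 0], because [sigma] cannot grow by more than the convection term
   dissipates. *)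
Lemma LN_stability (eps beta B1 : R) (b c : R -> R) (x e S' : nat -> R) (N : nat) :
  0 < eps -> 0 < beta -> 0 <= B1 -> (1 <= N)%nat ->
  (forall i, (i < N)%nat -> x i < x (S i)) ->
  (forall i, (S i < N)%nat -> x (S i) - x i <= x (S (S i)) - x (S i)) ->
  (forall i, (i < N)%nat -> B1 * (x (S i) - x i) <= beta / 4) ->
  (forall i, (i < N)%nat -> b (x i) - b (x (S i)) <= B1 * (x (S i) - x i)) ->
  (forall i, (i <= N)%nat -> beta < b (x i)) ->
  (forall i, (i <= N)%nat -> 0 <= c (x i)) ->
  e 0%nat = 0 -> e N = 0 ->
  (forall n, (S n < N)%nat ->
     (x (S (S n)) - x n) / 2 * Rabs (LN eps b c x e (S n)) <= S' (S n) - S' n) ->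
  forall i, (i <= N)%nat -> Rabs (e i) <= 4 / beta * (S' (N - 1)%nat - S' 0%nat).
Proof.
intros He Hbeta HB1 HN Hx Hgrow Hsmall Hlip Hb Hc E0 EN HS.
pose (s := fun i => sigma (b (x i) * (x (S i) - x i) / (2 * eps))).
pose (tau := fun i => Rabs (LN eps b c x e i)).
pose (hb := fun n => (x (S n) - x n + (x (S (S n)) - x (S n))) / 2).
(* [P 0 = 0] makes the barrier flat over the first step. At the left end the barrier only has to be
   nonnegative, and its value there, [T N], is the bound sought. *)
pose (P := nat_rect (fun _ => R) 0 (fun n p =>
  (eps * s (S n) / hb n * p + tau (S n)) / (eps * s (S n) / hb n + b (x (S n))))).
pose (T := nat_rect (fun _ => R) 0 (fun n t => t + (x (S n) - x n) * P n)).
assert (Hspos : forall i, (i < N)%nat -> 0 < s i).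
{ intros i Hi. apply sigma_bounds. specialize (Hx i Hi). specialize (Hb i ltac:(lia)).
  apply Rdiv_lt_0_compat; [apply Rmult_lt_0_compat|]; lra. }
assert (Hhb : forall n, (S n < N)%nat -> 0 < hb n).
{ intros n Hn. pose proof (Hx n ltac:(lia)). pose proof (Hx (S n) ltac:(lia)).
  unfold hb; lra. }
assert (Hden : forall n, (S n < N)%nat -> 0 < eps * s (S n) / hb n).
{ intros n Hn. apply Rdiv_lt_0_compat; [|now apply Hhb].
  apply Rmult_lt_0_compat; [lra|]. apply Hspos; lia. }
assert (HP : forall n, (n < N)%nat -> 0 <= P n).
{ induction n as [|n IH]; intros Hn; [unfold P; simpl; lra|].
  specialize (IH ltac:(lia)). pose proof (Hden n Hn). pose proof (Hb (S n) ltac:(lia)).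
  change (P (S n)) with ((eps * s (S n) / hb n * P n + tau (S n)) /
    (eps * s (S n) / hb n + b (x (S n)))).
  apply Rdiv_le_0_compat; [|lra].
  apply Rplus_le_le_0_compat; [apply Rmult_le_pos; lra|apply Rabs_pos]. }
assert (HPrec : forall n, (S n < N)%nat ->
  eps * s (S n) / hb n * (P (S n) - P n) + b (x (S n)) * P (S n) = tau (S n)).
{ intros n Hn. pose proof (Hden n Hn). pose proof (Hb (S n) ltac:(lia)).
  assert (P (S n) * (eps * s (S n) / hb n + b (x (S n))) = eps * s (S n) / hb n * P n + tau (S n)).
  { change (P (S n)) with ((eps * s (S n) / hb n * P n + tau (S n)) /
      (eps * s (S n) / hb n + b (x (S n)))).
    unfold Rdiv at 1. rewrite Rmult_assoc, Rinv_l; lra. }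
  lra. }
(* Convection yields at least [beta / 2] times the forward step times [P]. Half of it is collected
   in [T]; the other half is the middle term, a reserve that pays for the growth of [sigma] at the
   next node. *)
assert (Hpot : forall n, (n < N)%nat ->
  beta / 4 * T (S n) + beta / 4 * ((x (S n) - x n) * P n) + eps * s n * P n
    <= S' n - S' 0%nat).
{ induction n as [|n IH]; intros Hn; [simpl; lra|].
  specialize (IH ltac:(lia)).
  change (T (S (S n))) with (T (S n) + (x (S (S n)) - x (S n)) * P (S n)).
  pose proof (HP n ltac:(lia)) as Pn. pose proof (HP (S n) Hn) as PSn.
  pose proof (HS n Hn) as HSn. fold (tau (S n)) in HSn.
  rewrite <- (HPrec n Hn) in HSn.
  pose proof (Hhb n Hn) as Hhbn.
  replace ((x (S (S n)) - x n) / 2) with (hb n) in HSn by (unfold hb; field).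
  replace (hb n * (eps * s (S n) / hb n * (P (S n) - P n) + b (x (S n)) * P (S n)))
    with (eps * s (S n) * (P (S n) - P n) + hb n * b (x (S n)) * P (S n)) in HSn by (field; lra).
  (* The steps do not shrink, so longer steps can only lower [sigma]. What remains is a decrease of
     [b] over one step; it contributes at most [B1] times the squared step, which [Hsmall] turns
     into [beta / 4] times the step. *)
  assert (Hs : eps * (s (S n) - s n) <= beta / 4 * (x (S n) - x n)).
  { pose proof (Hx n ltac:(lia)) as X1. pose proof (Hx (S n) ltac:(lia)) as X2.
    pose proof (Hb n ltac:(lia)) as Bn. pose proof (Hb (S n) ltac:(lia)) as BSn.
    pose proof (Hgrow n ltac:(lia)) as G. pose proof (Hsmall n ltac:(lia)) as Sm.
    pose proof (Hlip n ltac:(lia)) as L.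
    pose proof (sigma_increment (b (x (S n)) * (x (S (S n)) - x (S n)) / (2 * eps))
      (b (x n) * (x (S n) - x n) / (2 * eps))) as I.
    fold (s n) in I. fold (s (S n)) in I.
    assert (A : s (S n) - s n <= beta / 4 * (x (S n) - x n) / eps).
    { eapply Rle_trans.
      - apply I; apply Rdiv_lt_0_compat; try lra; apply Rmult_lt_0_compat; lra.
      - apply Rmax_lub.
        + apply Rdiv_le_0_compat; [|lra]. apply Rmult_le_pos; lra.
        + apply Rmult_le_reg_r with eps; [lra|]. field_simplify; try lra. nra. }
    apply Rmult_le_compat_l with (r := eps) in A; [|lra].
    replace (eps * (beta / 4 * (x (S n) - x n) / eps)) with (beta / 4 * (x (S n) - x n)) in A
      by (field; lra).
    exact A. }
  assert (H1 : eps * (s (S n) - s n) * P n <= beta / 4 * (x (S n) - x n) * P n)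
    by (apply Rmult_le_compat_r; lra).
  assert (H2 : beta / 2 * (x (S (S n)) - x (S n)) * P (S n) <= hb n * b (x (S n)) * P (S n)).
  { apply Rmult_le_compat_r; [lra|].
    pose proof (Hx n ltac:(lia)) as X1. pose proof (Hx (S n) ltac:(lia)) as X2.
    pose proof (Hb (S n) ltac:(lia)) as BSn.
    apply Rle_trans with (hb n * beta); [|apply Rmult_le_compat_l; lra].
    unfold hb. nra. }
  lra. }
assert (HTmono : forall n, (n <= N)%nat -> 0 <= T n).
{ induction n as [|n IH]; intros Hn; [simpl; lra|].
  change (T (S n)) with (T n + (x (S n) - x n) * P n).
  specialize (IH ltac:(lia)). pose proof (Hx n ltac:(lia)). pose proof (HP n ltac:(lia)). nra. }
assert (HT : T N <= 4 / beta * (S' (N - 1)%nat - S' 0%nat)).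
{ pose proof (Hpot (N - 1)%nat ltac:(lia)) as H.
  replace (S (N - 1)) with N in H by lia.
  pose proof (HP (N - 1)%nat ltac:(lia)). pose proof (Hspos (N - 1)%nat ltac:(lia)).
  pose proof (Hx (N - 1)%nat ltac:(lia)) as X. replace (S (N - 1)) with N in X by lia.
  apply Rmult_le_reg_l with (beta / 4); [lra|].
  replace (beta / 4 * (4 / beta * (S' (N - 1)%nat - S' 0%nat))) with (S' (N - 1)%nat - S' 0%nat)
    by (field; lra).
  assert (0 <= (x N - x (N - 1)%nat) * P (N - 1)%nat) by (apply Rmult_le_pos; lra).
  assert (0 <= eps * s (N - 1)%nat * P (N - 1)%nat) by (apply Rmult_le_pos; nra).
  nra. }
assert (HY : forall n, (S n < N)%nat -> tau (S n) <= LN eps b c x (fun i => T N - T i) (S n)).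
{ intros n Hn. rewrite LN_S.
  change (T (S (S n))) with (T (S n) + (x (S (S n)) - x (S n)) * P (S n)).
  change (T (S n)) with (T n + (x (S n) - x n) * P n).
  fold (s (S n)). fold (hb n).
  pose proof (Hx n ltac:(lia)) as X1. pose proof (Hx (S n) ltac:(lia)) as X2.
  set (h1 := x (S n) - x n) in *. set (h2 := x (S (S n)) - x (S n)) in *.
  assert (0 < h1) by (unfold h1; lra). assert (0 < h2) by (unfold h2; lra).
  rewrite <- (HPrec n Hn).
  replace ((T N - (T n + h1 * P n + h2 * P (S n)) - (T N - (T n + h1 * P n))) / h2)
    with (- P (S n)) by (field; lra).
  replace ((T N - (T n + h1 * P n) - (T N - T n)) / h1) with (- P n) by (field; lra).
  assert (Hle : T n + h1 * P n <= T N).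
  { change (T (S n) <= T N). clear - Hn HTmono Hx HP.
    assert (M : forall k, (S n + k <= N)%nat -> T (S n) <= T (S n + k)%nat).
    { induction k as [|k IH]; intros Hk; [rewrite Nat.add_0_r; lra|].
      rewrite Nat.add_succ_r.
      change (T (S (S n + k))) with (T (S n + k)%nat + (x (S (S n + k)) - x (S n + k)%nat) * P (S n + k)%nat).
      specialize (IH ltac:(lia)). pose proof (Hx (S n + k)%nat ltac:(lia)).
      pose proof (HP (S n + k)%nat ltac:(lia)). nra. }
    specialize (M (N - S n)%nat ltac:(lia)). now replace (S n + (N - S n))%nat with N in M by lia. }
  pose proof (Hc (S n) ltac:(lia)) as Cn. pose proof (Hhb n Hn).
  assert (0 <= c (x (S n)) * (T N - (T n + h1 * P n))) by (apply Rmult_le_pos; lra).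
  replace (- eps * s (S n) * ((- P (S n) - - P n) / hb n))
    with (eps * s (S n) / hb n * (P (S n) - P n)) by (field; lra).
  lra. }
intros i Hi.
assert (HTi : T N - T i <= T N) by (specialize (HTmono i Hi); lra).
apply Rle_trans with (2 := HT). apply Rle_trans with (2 := HTi).
assert (Hbpos : forall i, (i <= N)%nat -> 0 < b (x i)) by (intros j Hj; specialize (Hb j Hj); lra).
assert (T0 : T 0%nat = 0) by reflexivity.
assert (TN0 : 0 <= T N) by (apply HTmono; lia).
apply Rabs_le; split.
- enough (0 <= T N - T i + e i) by lra.
  apply (discrete_maximum_principle eps b c x (fun i => T N - T i + e i) N); try easy; try lra.
  intros n Hn. rewrite (LN_plus _ _ _ _ (fun i => T N - T i) e).
  specialize (HY n Hn). pose proof (Rle_abs (- LN eps b c x e (S n))) as A.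
  rewrite Rabs_Ropp in A. unfold tau in HY. lra.
- enough (0 <= T N - T i - e i) by lra.
  apply (discrete_maximum_principle eps b c x (fun i => T N - T i - e i) N); try easy; try lra.
  intros n Hn. rewrite (LN_minus _ _ _ _ (fun i => T N - T i) e).
  specialize (HY n Hn). pose proof (Rle_abs (LN eps b c x e (S n))) as A.
  unfold tau in HY. lra.
Qed.

(** * Comparison principles and derivative bounds for the layer function *)

Lemma lower_value_left (q : R -> R) (y z l : R) :
  is_derive q z l -> 0 < l -> y < z -> exists t, y < t < z /\ q t < q z.
Proof.
intros Hd Hl Hyz. apply is_derive_Reals in Hd. destruct (Hd l Hl) as [d Hdl].
pose proof (cond_pos d) as Hdp.
set (k := Rmin (d / 2) ((z - y) / 2)).
assert (Hk : 0 < k) by (apply Rmin_glb_lt; lra).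
assert (Hk1 : k <= d / 2) by apply Rmin_l. assert (Hk2 : k <= (z - y) / 2) by apply Rmin_r.
exists (z + - k). split; [lra|].
specialize (Hdl (- k) ltac:(lra)). rewrite Rabs_Ropp, Rabs_pos_eq in Hdl by lra.
specialize (Hdl ltac:(lra)). apply Rabs_lt_between in Hdl.
assert (0 < (q (z + - k) - q z) / - k) by lra.
assert (E : q (z + - k) - q z = (q (z + - k) - q z) / - k * - k) by (field; lra).
nra.
Qed.

Lemma lower_value_right (q : R -> R) (y z l : R) :
  is_derive q z l -> l < 0 -> z < y -> exists t, z < t < y /\ q t < q z.
Proof.
intros Hd Hl Hyz.
assert (D : is_derive (fun s => q (- s)) (- z) (- l)).
{ assert (ex_derive (fun t : R => q t) (- - z)) by (rewrite Ropp_involutive; now exists l).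
  auto_derive; [easy|].
  rewrite Ropp_involutive, (is_derive_unique (fun t : R => q t) _ _ Hd). ring. }
destruct (lower_value_left _ (- y) (- z) (- l) D) as [t [Ht Hq]]; try lra.
rewrite Ropp_involutive in Hq. exists (- t). split; [lra|exact Hq].
Qed.

(** At a negative minimum beyond [y] the derivative would be positive, and [q] would be smaller
    still just to the left. The derivative condition is imposed only where [q] is negative, because
    there the zeroth-order term of a differential inequality has the favourable sign. *)
Lemma nonneg_forward (q q' : R -> R) (y x : R) :
  y <= x ->
  (forall z, y <= z <= x -> continuity_pt q z) ->
  (forall z, y < z <= x -> is_derive q z (q' z)) ->
  (forall z, y < z <= x -> q z < 0 -> 0 < q' z) ->
  0 <= q y -> 0 <= q x.
Proof.
intros Hyx Hc Hd Hq H0.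
destruct (continuity_ab_min q y x Hyx Hc) as [z [Hmin Hz]].
destruct (Rle_dec 0 (q z)) as [Hp|Hn]; [specialize (Hmin x ltac:(lra)); lra|].
exfalso. destruct (Req_dec z y) as [->|Hzy]; [lra|].
destruct (lower_value_left q y z (q' z)) as [t [Ht Hqt]]; [apply Hd; lra|apply Hq; lra|lra|].
specialize (Hmin t ltac:(lra)). lra.
Qed.

Lemma nonneg_backward (q q' : R -> R) (y x : R) :
  x <= y ->
  (forall z, x <= z <= y -> continuity_pt q z) ->
  (forall z, x <= z < y -> is_derive q z (q' z)) ->
  (forall z, x <= z < y -> q z < 0 -> q' z < 0) ->
  0 <= q y -> 0 <= q x.
Proof.
intros Hyx Hc Hd Hq H0.
destruct (continuity_ab_min q x y Hyx Hc) as [z [Hmin Hz]].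
destruct (Rle_dec 0 (q z)) as [Hp|Hn]; [specialize (Hmin x ltac:(lra)); lra|].
exfalso. destruct (Req_dec z y) as [->|Hzy]; [lra|].
destruct (lower_value_right q y z (q' z)) as [t [Ht Hqt]]; [apply Hd; lra|apply Hq; lra|lra|].
specialize (Hmin t ltac:(lra)). lra.
Qed.

Lemma maximum_principle (eps : R) (b c p p1 p2 : R -> R) :
  0 < eps ->
  (forall x, 0 < x < 1 -> 0 <= c x) ->
  (forall x, 0 <= x <= 1 -> continuity_pt p x) ->
  (forall x, 0 < x < 1 -> is_derive p x (p1 x)) ->
  (forall x, 0 < x < 1 -> is_derive p1 x (p2 x)) ->
  (forall x, 0 < x < 1 -> 0 < - eps * p2 x - b x * p1 x + c x * p x) ->
  0 <= p 0 -> 0 <= p 1 ->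
  forall x, 0 <= x <= 1 -> 0 <= p x.
Proof.
intros He Hcpos Hc Hd1 Hd2 HL H0 H1 x Hx.
destruct (continuity_ab_min p 0 1 ltac:(lra) Hc) as [z [Hmin Hz]].
destruct (Rle_dec 0 (p z)) as [Hp|Hn]; [specialize (Hmin x Hx); lra|].
exfalso.
assert (Hz01 : 0 < z < 1).
{ split; apply Rnot_le_lt; intros A;
   [replace z with 0 in Hn by lra|replace z with 1 in Hn by lra]; lra. }
assert (Hp1 : p1 z = 0).
{ destruct (Rtotal_order (p1 z) 0) as [N|[E|N]]; [|exact E|].
  - destruct (lower_value_right p 1 z (p1 z)) as [t [Ht Hpt]]; [apply Hd1; lra|lra|lra|].
    specialize (Hmin t ltac:(lra)); lra.
  - destruct (lower_value_left p 0 z (p1 z)) as [t [Ht Hpt]]; [apply Hd1; lra|lra|lra|].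
    specialize (Hmin t ltac:(lra)); lra. }
(* If [p2 z] were negative, the difference quotient of [p1] at [z], where [p1] vanishes, would make
   [p1] negative just to the right of [z], and [p] would fall below its minimum. The argument uses
   [p2] at the single point [z], not its continuity. *)
assert (Hp2 : 0 <= p2 z).
{ apply Rnot_lt_le; intros N.
  pose proof (Hd2 z Hz01) as D. apply is_derive_Reals in D.
  destruct (D (- p2 z) ltac:(lra)) as [d Hdl]. pose proof (cond_pos d) as Hdp.
  set (k := Rmin (d / 2) ((1 - z) / 2)).
  assert (Hk : 0 < k) by (apply Rmin_glb_lt; lra).
  assert (Hk1 : k <= d / 2) by apply Rmin_l. assert (Hk2 : k <= (1 - z) / 2) by apply Rmin_r.
  destruct (mvt_open p p1 z (z + k)) as [s [Hs E]]; [lra| | |].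
  - intros t Ht; apply Hc; lra.
  - intros t Ht; apply Hd1; lra.
  - specialize (Hdl (s - z) ltac:(lra)). rewrite Rabs_pos_eq in Hdl by lra.
    specialize (Hdl ltac:(lra)). apply Rabs_lt_between in Hdl.
    rewrite Hp1 in Hdl. replace (z + (s - z)) with s in Hdl by ring.
    assert ((p1 s - 0) / (s - z) < 0) by lra.
    assert (p1 s = (p1 s - 0) / (s - z) * (s - z)) by (field; lra).
    assert (p1 s < 0) by nra.
    specialize (Hmin (z + k) ltac:(lra)).
    replace (z + k - z) with k in E by ring. nra. }
specialize (HL z Hz01). rewrite Hp1 in HL. specialize (Hcpos z Hz01). nra.
Qed.

(** Only [beta], [delta] and [M] may enter the constants. The bounds that follow give a formula in
    them or choose the constant before [eps] and all functions, so uniformity in [eps] can be read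
    off. The gap [delta] comes from the minimum of [b] on the compact interval. *)
Record coef_bounds (beta delta M : R) (b b1 b2 c c1 c2 : R -> R) : Prop := {
  cb_beta : 0 < beta;
  cb_delta : 0 < delta;
  cb_M : 1 <= M;
  cb_b1 : forall x, 0 <= x <= 1 -> is_derive b x (b1 x);
  cb_b2 : forall x, 0 <= x <= 1 -> is_derive b1 x (b2 x);
  cb_c1 : forall x, 0 <= x <= 1 -> is_derive c x (c1 x);
  cb_c2 : forall x, 0 <= x <= 1 -> is_derive c1 x (c2 x);
  cb_b_lower : forall x, 0 <= x <= 1 -> beta + delta <= b x;
  cb_c_lower : forall x, 0 <= x <= 1 -> 0 <= c x;
  cb_b_bound : forall x, 0 <= x <= 1 -> Rabs (b x) <= M;
  cb_b1_bound : forall x, 0 <= x <= 1 -> Rabs (b1 x) <= M;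
  cb_b2_bound : forall x, 0 <= x <= 1 -> Rabs (b2 x) <= M;
  cb_c_bound : forall x, 0 <= x <= 1 -> Rabs (c x) <= M;
  cb_c1_bound : forall x, 0 <= x <= 1 -> Rabs (c1 x) <= M;
  cb_c2_bound : forall x, 0 <= x <= 1 -> Rabs (c2 x) <= M }.

(* The problem solved by [w = u - u0], with [g = u0'']. *)
Record layer_problem (M eps : R) (b c g w w1 w2 : R -> R) : Prop := {
  lp_eps : 0 < eps < 1;
  lp_cont : forall x, 0 <= x <= 1 -> continuity_pt w x;
  lp_w1 : forall x, 0 < x < 1 -> is_derive w x (w1 x);
  lp_w2 : forall x, 0 < x < 1 -> is_derive w1 x (w2 x);
  lp_eq : forall x, 0 < x < 1 -> - eps * w2 x - b x * w1 x + c x * w x = eps * g x;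
  lp_g_bound : forall x, 0 < x < 1 -> Rabs (g x) <= M;
  lp_g_lip : forall x y, 0 < x < 1 -> 0 < y < 1 -> Rabs (g x - g y) <= M * Rabs (x - y);
  lp_0 : Rabs (w 0) <= M;
  lp_1 : w 1 = 0 }.

Lemma Rabs_mult_le (x y A B : R) : Rabs x <= A -> Rabs y <= B -> Rabs (x * y) <= A * B.
Proof.
intros H1 H2. rewrite Rabs_mult. apply Rmult_le_compat; trivial; apply Rabs_pos.
Qed.

Lemma layer_value_bound (beta delta M eps : R) (b b1 b2 c c1 c2 g w w1 w2 : R -> R) :
  coef_bounds beta delta M b b1 b2 c c1 c2 ->
  layer_problem M eps b c g w w1 w2 ->
  forall x, 0 <= x <= 1 ->
  Rabs (w x) <= M * exp (- beta * x / eps) + (M + 1) / beta * eps.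
Proof.
intros CB LP x Hx.
pose proof (lp_eps _ _ _ _ _ _ _ _ LP) as He.
pose proof (cb_beta _ _ _ _ _ _ _ _ _ CB) as Hbeta.
pose proof (cb_M _ _ _ _ _ _ _ _ _ CB) as HM.
pose proof (cb_delta _ _ _ _ _ _ _ _ _ CB) as Hdel.
(* The exponential is a supersolution because [beta < b], and the linear term dominates [eps * g].
   Having [M + 1] in place of [M] supplies the strict inequality that [maximum_principle]
   requires. *)
pose (phi := fun z => M * exp (- beta * z / eps) + (M + 1) / beta * eps * (1 - z)).
pose (phi1 := fun z => M * (- beta / eps) * exp (- beta * z / eps) - (M + 1) / beta * eps).
pose (phi2 := fun z => M * (- beta / eps) * (- beta / eps) * exp (- beta * z / eps)).
assert (D1 : forall z, is_derive phi z (phi1 z)).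
{ intros z. unfold phi, phi1. auto_derive; [easy|]. unfold Rdiv, Rminus; field; lra. }
assert (D2 : forall z, is_derive phi1 z (phi2 z)).
{ intros z. unfold phi1, phi2. auto_derive; [easy|]. unfold Rdiv, Rminus; field; lra. }
assert (HK : 0 <= (M + 1) / beta * eps).
{ apply Rmult_le_pos; [apply Rdiv_le_0_compat|]; lra. }
assert (HL : forall z, 0 < z < 1 ->
   M * eps < - eps * phi2 z - b z * phi1 z + c z * phi z).
{ intros z Hz. unfold phi, phi1, phi2.
  pose proof (cb_b_lower _ _ _ _ _ _ _ _ _ CB z ltac:(lra)) as Bz.
  pose proof (cb_c_lower _ _ _ _ _ _ _ _ _ CB z ltac:(lra)) as Cz.
  set (E := exp (- beta * z / eps)). assert (HE : 0 < E) by apply exp_pos.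
  replace (- eps * (M * (- beta / eps) * (- beta / eps) * E)
    - b z * (M * (- beta / eps) * E - (M + 1) / beta * eps)
    + c z * (M * E + (M + 1) / beta * eps * (1 - z)))
  with (M * E * (beta / eps) * (b z - beta) + c z * (M * E + (M + 1) / beta * eps * (1 - z))
    + (M + 1) * eps / beta * b z) by (field; lra).
  assert (0 <= M * E * (beta / eps) * (b z - beta)).
  { apply Rmult_le_pos; [apply Rmult_le_pos; [nra|apply Rdiv_le_0_compat; lra]|lra]. }
  assert (0 <= c z * (M * E + (M + 1) / beta * eps * (1 - z))).
  { apply Rmult_le_pos; [lra|]. apply Rplus_le_le_0_compat; [nra|].
    apply Rmult_le_pos; lra. }
  assert ((M + 1) * eps <= (M + 1) * eps / beta * b z).
  { replace ((M + 1) * eps) with ((M + 1) * eps / beta * beta) at 1 by (field; lra).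
    apply Rmult_le_compat_l; [apply Rdiv_le_0_compat; nra|lra]. }
  lra. }
pose proof (lp_0 _ _ _ _ _ _ _ _ LP) as W0. apply Rabs_le_between in W0.
pose proof (lp_1 _ _ _ _ _ _ _ _ LP) as W1.
assert (P0 : phi 0 = M + (M + 1) / beta * eps).
{ unfold phi. replace (- beta * 0 / eps) with 0 by (field; lra). rewrite exp_0; ring. }
assert (P1 : 0 <= phi 1).
{ unfold phi. pose proof (exp_pos (- beta * 1 / eps)). nra. }
assert (Hcont : forall z, continuity_pt phi z) by (intros z; exact (is_derive_continuity_pt _ _ _ (D1 z))).
assert (Hc : forall z, 0 < z < 1 -> 0 <= c z).
{ intros z Hz. apply (cb_c_lower _ _ _ _ _ _ _ _ _ CB); lra. }
assert (Hphi : phi x <= M * exp (- beta * x / eps) + (M + 1) / beta * eps) by (unfold phi; nra).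
apply Rle_trans with (2 := Hphi). apply Rabs_le; split.
- enough (0 <= phi x + w x) by lra.
  apply (maximum_principle eps b c (fun z => phi z + w z) (fun z => phi1 z + w1 z)
    (fun z => phi2 z + w2 z)); trivial; try lra.
  + intros z Hz. apply continuity_pt_plus; [apply Hcont|]. now apply (lp_cont _ _ _ _ _ _ _ _ LP).
  + intros z Hz. apply (is_derive_plus phi w); [apply D1|now apply (lp_w1 _ _ _ _ _ _ _ _ LP)].
  + intros z Hz. apply (is_derive_plus phi1 w1); [apply D2|now apply (lp_w2 _ _ _ _ _ _ _ _ LP)].
  + intros z Hz. specialize (HL z Hz). pose proof (lp_eq _ _ _ _ _ _ _ _ LP z Hz).
    pose proof (lp_g_bound _ _ _ _ _ _ _ _ LP z Hz) as G. apply Rabs_le_between in G. nra.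
- enough (0 <= phi x - w x) by lra.
  apply (maximum_principle eps b c (fun z => phi z - w z) (fun z => phi1 z - w1 z)
    (fun z => phi2 z - w2 z)); trivial; try lra.
  + intros z Hz. apply continuity_pt_minus; [apply Hcont|]. now apply (lp_cont _ _ _ _ _ _ _ _ LP).
  + intros z Hz. apply (is_derive_minus phi w); [apply D1|now apply (lp_w1 _ _ _ _ _ _ _ _ LP)].
  + intros z Hz. apply (is_derive_minus phi1 w1); [apply D2|now apply (lp_w2 _ _ _ _ _ _ _ _ LP)].
  + intros z Hz. specialize (HL z Hz). pose proof (lp_eq _ _ _ _ _ _ _ _ LP z Hz).
    pose proof (lp_g_bound _ _ _ _ _ _ _ _ LP z Hz) as G. apply Rabs_le_between in G. nra.
Qed.

(** The flux [eps w' + b w] has the bounded derivative [c w - eps g + b' w]. It is bounded at one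
    point, since the mean value theorem gives [w' = - w 0] somewhere, hence it is bounded
    everywhere. *)
Lemma layer_derive_crude (beta delta M eps : R) (b b1 b2 c c1 c2 g w w1 w2 : R -> R) :
  coef_bounds beta delta M b b1 b2 c c1 c2 ->
  layer_problem M eps b c g w w1 w2 ->
  forall x, 0 < x < 1 ->
  eps * Rabs (w1 x) <= 2 * M + 4 * M * (M + (M + 1) / beta).
Proof.
intros CB LP x Hx.
pose proof (lp_eps _ _ _ _ _ _ _ _ LP) as He.
pose proof (cb_beta _ _ _ _ _ _ _ _ _ CB) as Hbeta.
pose proof (cb_M _ _ _ _ _ _ _ _ _ CB) as HM.
set (W := M + (M + 1) / beta).
assert (HW : forall z, 0 <= z <= 1 -> Rabs (w z) <= W).
{ intros z Hz.
  eapply Rle_trans; [exact (layer_value_bound _ _ _ _ _ _ _ _ _ _ _ _ _ _ CB LP z Hz)|].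
  assert (exp (- beta * z / eps) <= 1).
  { rewrite <- exp_0. apply exp_nondecreasing. replace (- beta * z / eps) with (- (beta * z / eps)) by (field; lra).
    assert (0 <= beta * z / eps) by (apply Rdiv_le_0_compat; nra). lra. }
  assert (0 <= (M + 1) / beta) by (apply Rdiv_le_0_compat; lra).
  unfold W. nra. }
assert (HW0 : 0 <= W) by (eapply Rle_trans; [apply Rabs_pos|apply (HW 0); lra]).
pose (v := fun z => eps * w1 z + b z * w z).
pose (v' := fun z => c z * w z - eps * g z + b1 z * w z).
assert (Dv : forall z, 0 < z < 1 -> is_derive v z (v' z)).
{ intros z Hz. unfold v, v'.
  pose proof (lp_w1 _ _ _ _ _ _ _ _ LP z Hz) as A1.
  pose proof (lp_w2 _ _ _ _ _ _ _ _ LP z Hz) as A2.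
  pose proof (cb_b1 _ _ _ _ _ _ _ _ _ CB z ltac:(lra)) as A3.
  auto_derive.
  - repeat split; [now exists (w2 z)|now exists (b1 z)|now exists (w1 z)].
  - rewrite (is_derive_unique (fun t : R => w1 t) _ _ A2), (is_derive_unique (fun t : R => w t) _ _ A1),
      (is_derive_unique (fun t : R => b t) _ _ A3).
    pose proof (lp_eq _ _ _ _ _ _ _ _ LP z Hz). lra. }
assert (Bv : forall z, 0 < z < 1 -> Rabs (v' z) <= 2 * (M * W) + M).
{ intros z Hz. unfold v'.
  pose proof (Rabs_mult_le _ _ _ _ (cb_c_bound _ _ _ _ _ _ _ _ _ CB z ltac:(lra)) (HW z ltac:(lra))) as A1.
  pose proof (Rabs_mult_le _ _ _ _ (cb_b1_bound _ _ _ _ _ _ _ _ _ CB z ltac:(lra)) (HW z ltac:(lra))) as A2.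
  pose proof (lp_g_bound _ _ _ _ _ _ _ _ LP z Hz) as A3.
  apply Rabs_le_between in A1. apply Rabs_le_between in A2. apply Rabs_le_between in A3.
  apply Rabs_le; split; nra. }
destruct (mvt_open w w1 0 1) as [y [Hy Ey]]; [lra| | |].
{ intros z Hz; now apply (lp_cont _ _ _ _ _ _ _ _ LP). }
{ intros z Hz; now apply (lp_w1 _ _ _ _ _ _ _ _ LP). }
rewrite (lp_1 _ _ _ _ _ _ _ _ LP) in Ey.
assert (Hw1y : Rabs (w1 y) <= M).
{ replace (w1 y) with (- w 0) by lra. rewrite Rabs_Ropp. apply (lp_0 _ _ _ _ _ _ _ _ LP). }
assert (Hvy : Rabs (v y) <= M + M * W).
{ unfold v.
  pose proof (Rabs_mult_le _ _ _ _ (cb_b_bound _ _ _ _ _ _ _ _ _ CB y ltac:(lra)) (HW y ltac:(lra))) as A1.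
  apply Rabs_le_between in A1. apply Rabs_le_between in Hw1y. apply Rabs_le; split; nra. }
assert (Hvd : Rabs (v x - v y) <= 2 * (M * W) + M).
{ assert (G : forall s t, 0 < s -> s < t -> t < 1 -> Rabs (v t - v s) <= 2 * (M * W) + M).
  { intros s t Hs Hst Ht.
    destruct (mvt_open v v' s t Hst) as [r [Hr Er]].
    - intros z Hz. apply (is_derive_continuity_pt _ _ (v' z)), Dv; lra.
    - intros z Hz; apply Dv; lra.
    - rewrite Er. rewrite <- (Rmult_1_r (2 * (M * W) + M)). apply Rabs_mult_le.
      + apply Bv; lra.
      + rewrite Rabs_pos_eq; lra. }
  destruct (Rtotal_order x y) as [L|[E|L]].
  - rewrite Rabs_minus_sym. apply G; lra.
  - rewrite E. unfold Rminus; rewrite Rplus_opp_r, Rabs_R0. nra.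
  - apply G; lra. }
pose proof (Rabs_mult_le _ _ _ _ (cb_b_bound _ _ _ _ _ _ _ _ _ CB x ltac:(lra)) (HW x ltac:(lra))) as A1.
replace (eps * Rabs (w1 x)) with (Rabs (v x - b x * w x)).
- apply Rabs_le_between in A1. apply Rabs_le_between in Hvd. apply Rabs_le_between in Hvy.
  apply Rabs_le; split; lra.
- unfold v. rewrite <- (Rabs_pos_eq eps) at 2 by lra. rewrite <- Rabs_mult. f_equal; ring.
Qed.

(** The slope [w'] solves the first-order equation [eps p' + b p = c w - eps g]. For [x <= eps] the
    exponential is at least [exp (- beta)] and the crude bound is enough; from [eps] on, [Psi] is
    compared with [w']. The gap [delta] is essential here: applied to the exponential part of [Psi],
    the operator leaves [K (b - beta) E / eps]. *)
Lemma layer_derive_bound (beta delta M : R) :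
  0 < beta -> 0 < delta -> 1 <= M ->
  exists K, 0 <= K /\
  forall (eps : R) (b b1 b2 c c1 c2 g w w1 w2 : R -> R),
  coef_bounds beta delta M b b1 b2 c c1 c2 ->
  layer_problem M eps b c g w w1 w2 ->
  forall x, 0 < x < 1 ->
  Rabs (w1 x) <= K * (exp (- beta * x / eps) / eps + eps).
Proof.
intros Hbeta Hdel HM.
set (K1 := 2 * M + 4 * M * (M + (M + 1) / beta)).
set (F2 := M * ((M + 1) / beta) + M).
assert (HQ : 0 <= (M + 1) / beta) by (apply Rdiv_le_0_compat; lra).
assert (HK1 : 0 <= K1) by (unfold K1; nra).
assert (HF2 : 0 <= F2) by (unfold F2; nra).
(* The summands serve, in this order, the range [x <= eps], the exponential part of the right-hand
   side and its part of size [eps]. *)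
set (K := K1 * exp beta + M * M / delta + F2 / beta).
assert (T1 : 0 <= K1 * exp beta) by (pose proof (exp_pos beta); nra).
assert (T2 : 0 <= M * M / delta) by (apply Rdiv_le_0_compat; nra).
assert (T3 : 0 <= F2 / beta) by (apply Rdiv_le_0_compat; lra).
assert (HKd : M * M <= K * delta).
{ replace (M * M) with (M * M / delta * delta) at 1 by (field; lra).
  apply Rmult_le_compat_r; unfold K; lra. }
assert (HKb : F2 <= K * beta).
{ replace F2 with (F2 / beta * beta) at 1 by (field; lra).
  apply Rmult_le_compat_r; unfold K; lra. }
exists K. split; [unfold K; lra|].
intros eps b b1 b2 c c1 c2 g w w1 w2 CB LP x Hx.
pose proof (lp_eps _ _ _ _ _ _ _ _ LP) as He.
pose (Psi := fun z => K * (exp (- beta * z / eps) / eps + eps)).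
change (Rabs (w1 x) <= Psi x).
assert (Hnear : forall z, 0 < z < 1 -> z <= eps -> Rabs (w1 z) <= Psi z).
{ intros z Hz Hze.
  pose proof (layer_derive_crude _ _ _ _ _ _ _ _ _ _ _ _ _ _ CB LP z Hz) as A. fold K1 in A.
  assert (B : exp (- beta) <= exp (- beta * z / eps)).
  { apply exp_nondecreasing. apply Rmult_le_reg_r with eps; [lra|]. field_simplify; nra. }
  assert (C : exp beta * exp (- beta) = 1) by (rewrite <- exp_plus, Rplus_opp_r; apply exp_0).
  unfold Psi. apply Rmult_le_reg_l with eps; [lra|].
  replace (eps * (K * (exp (- beta * z / eps) / eps + eps)))
    with (K * exp (- beta * z / eps) + K * (eps * eps)) by (field; lra).
  assert (K1 <= K * exp (- beta * z / eps)).
  { apply Rle_trans with (K1 * exp beta * exp (- beta)); [rewrite Rmult_assoc, C; lra|].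
    pose proof (exp_pos (- beta)). apply Rmult_le_compat; unfold K in *; lra. }
  assert (0 <= K) by (unfold K; lra). nra. }
destruct (Rle_dec x eps) as [Hxe|Hxe]; [now apply Hnear|].
specialize (Hnear eps ltac:(lra) ltac:(lra)).
pose (Psi' := fun z => K * (- beta / eps * exp (- beta * z / eps) / eps)).
assert (DP : forall z, is_derive Psi z (Psi' z)).
{ intros z. unfold Psi, Psi'. auto_derive; [easy|]. unfold Rdiv, Rminus; field; lra. }
assert (HF : forall z, 0 < z < 1 ->
   Rabs (c z * w z - eps * g z) <= M * M * exp (- beta * z / eps) + F2 * eps).
{ intros z Hz.
  pose proof (Rabs_mult_le _ _ _ _ (cb_c_bound _ _ _ _ _ _ _ _ _ CB z ltac:(lra))
    (layer_value_bound _ _ _ _ _ _ _ _ _ _ _ _ _ _ CB LP z ltac:(lra))) as A1.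
  pose proof (lp_g_bound _ _ _ _ _ _ _ _ LP z Hz) as A3.
  apply Rabs_le_between in A1. apply Rabs_le_between in A3.
  unfold F2. apply Rabs_le; split; nra. }
assert (Hdiff : forall z, 0 < z < 1 ->
   M * M * exp (- beta * z / eps) + F2 * eps <= eps * Psi' z + b z * Psi z).
{ intros z Hz. unfold Psi, Psi'. set (E := exp (- beta * z / eps)).
  assert (HE : 0 < E) by apply exp_pos.
  pose proof (cb_b_lower _ _ _ _ _ _ _ _ _ CB z ltac:(lra)) as Bz.
  replace (eps * (K * (- beta / eps * E / eps)) + b z * (K * (E / eps + eps)))
    with (K * (b z - beta) * (E / eps) + K * b z * eps) by (field; lra).
  assert (E <= E / eps).
  { apply Rmult_le_reg_r with eps; [lra|]. replace (E / eps * eps) with E by (field; lra). nra. }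
  assert (0 <= K) by (unfold K; lra).
  apply Rplus_le_compat.
  - apply Rmult_le_compat; try nra.
  - apply Rmult_le_compat_r; [lra|]. nra. }
apply Rabs_le_between in Hnear.
apply Rabs_le; split.
- enough (0 <= Psi x + w1 x) by lra.
  apply (nonneg_forward (fun z => Psi z + w1 z) (fun z => Psi' z + w2 z) eps x); try lra.
  + intros z Hz. apply continuity_pt_plus; [exact (is_derive_continuity_pt _ _ _ (DP z))|].
    apply (is_derive_continuity_pt _ _ (w2 z)), (lp_w2 _ _ _ _ _ _ _ _ LP); lra.
  + intros z Hz. apply (is_derive_plus Psi w1); [apply DP|apply (lp_w2 _ _ _ _ _ _ _ _ LP); lra].
  + intros z Hz Hneg. specialize (HF z ltac:(lra)). specialize (Hdiff z ltac:(lra)).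
    pose proof (lp_eq _ _ _ _ _ _ _ _ LP z ltac:(lra)).
    pose proof (cb_b_lower _ _ _ _ _ _ _ _ _ CB z ltac:(lra)) as Bz.
    apply Rabs_le_between in HF.
    assert (0 < b z * - (Psi z + w1 z)) by (apply Rmult_lt_0_compat; lra).
    apply Rmult_lt_reg_l with eps; lra.
- enough (0 <= Psi x - w1 x) by lra.
  apply (nonneg_forward (fun z => Psi z - w1 z) (fun z => Psi' z - w2 z) eps x); try lra.
  + intros z Hz. apply continuity_pt_minus; [exact (is_derive_continuity_pt _ _ _ (DP z))|].
    apply (is_derive_continuity_pt _ _ (w2 z)), (lp_w2 _ _ _ _ _ _ _ _ LP); lra.
  + intros z Hz. apply (is_derive_minus Psi w1); [apply DP|apply (lp_w2 _ _ _ _ _ _ _ _ LP); lra].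
  + intros z Hz Hneg. specialize (HF z ltac:(lra)). specialize (Hdiff z ltac:(lra)).
    pose proof (lp_eq _ _ _ _ _ _ _ _ LP z ltac:(lra)).
    pose proof (cb_b_lower _ _ _ _ _ _ _ _ _ CB z ltac:(lra)) as Bz.
    apply Rabs_le_between in HF.
    assert (0 < b z * - (Psi z - w1 z)) by (apply Rmult_lt_0_compat; lra).
    apply Rmult_lt_reg_l with eps; lra.
Qed.

(** The bound for [w2] is read off the equation, by dividing [c w - b w1 - eps g] by [eps]. *)
Lemma layer_bounds (beta delta M : R) :
  0 < beta -> 0 < delta -> 1 <= M ->
  exists K, 1 <= K /\
  forall (eps : R) (b b1 b2 c c1 c2 g w w1 w2 : R -> R),
  coef_bounds beta delta M b b1 b2 c c1 c2 ->
  layer_problem M eps b c g w w1 w2 ->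
  forall x, 0 < x < 1 ->
  Rabs (w x) <= K * (eps + exp (- beta * x / eps)) /\
  Rabs (w1 x) <= K * (eps + exp (- beta * x / eps) / eps) /\
  Rabs (w2 x) <= K * (1 + exp (- beta * x / eps) / (eps * eps)).
Proof.
intros Hbeta Hdel HM.
destruct (layer_derive_bound beta delta M Hbeta Hdel HM) as [K1 [HK1 HD]].
set (K0 := M + (M + 1) / beta).
assert (HQ : 0 <= (M + 1) / beta) by (apply Rdiv_le_0_compat; lra).
exists (K0 + K1 + (M * K1 + M * K0 + M)).
split; [unfold K0; nra|].
intros eps b b1 b2 c c1 c2 g w w1 w2 CB LP x Hx.
pose proof (lp_eps _ _ _ _ _ _ _ _ LP) as He.
pose proof (layer_value_bound _ _ _ _ _ _ _ _ _ _ _ _ _ _ CB LP x ltac:(lra)) as A0.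
pose proof (HD _ _ _ _ _ _ _ _ _ _ _ CB LP x Hx) as A1.
set (E := exp (- beta * x / eps)) in *.
assert (HE : 0 < E) by apply exp_pos.
assert (HE1 : E <= E / eps).
{ apply Rmult_le_reg_r with eps; [lra|]. replace (E / eps * eps) with E by (field; lra). nra. }
assert (HE2 : E / eps <= E / (eps * eps)).
{ apply Rmult_le_reg_r with (eps * eps); [nra|].
  replace (E / (eps * eps) * (eps * eps)) with E by (field; lra).
  replace (E / eps * (eps * eps)) with (E * eps) by (field; lra). nra. }
assert (B0 : Rabs (w x) <= K0 * (eps + E)) by (unfold K0; nra).
assert (HK0 : 1 <= K0) by (unfold K0; lra).
assert (MK1 : 0 <= M * K1) by nra. assert (MK0 : 0 <= M * K0) by nra.
split; [|split].
- eapply Rle_trans; [exact B0|]. apply Rmult_le_compat_r; lra.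
- eapply Rle_trans; [exact A1|]. rewrite (Rplus_comm _ eps). apply Rmult_le_compat_r; lra.
- apply Rle_trans with ((M * K1 + M * K0 + M) * (1 + E / (eps * eps))); [|apply Rmult_le_compat_r; lra].
  apply Rmult_le_reg_l with eps; [lra|].
  replace (eps * Rabs (w2 x)) with (Rabs (c x * w x - b x * w1 x - eps * g x)).
  2: { rewrite <- (Rabs_pos_eq eps) at 2 by lra. rewrite <- Rabs_mult. f_equal.
       pose proof (lp_eq _ _ _ _ _ _ _ _ LP x Hx). lra. }
  pose proof (Rabs_mult_le _ _ _ _ (cb_c_bound _ _ _ _ _ _ _ _ _ CB x ltac:(lra)) B0) as C0.
  pose proof (Rabs_mult_le _ _ _ _ (cb_b_bound _ _ _ _ _ _ _ _ _ CB x ltac:(lra)) A1) as C1.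
  pose proof (lp_g_bound _ _ _ _ _ _ _ _ LP x Hx) as C2.
  assert (HE3 : eps * (E / (eps * eps)) = E / eps) by (field; lra).
  assert (N0 : 0 <= M * K0 * (E / eps - E)) by (apply Rmult_le_pos; lra).
  assert (N1 : 0 <= M * (E / eps)) by (apply Rmult_le_pos; lra).
  assert (N2 : eps * Rabs (g x) <= eps * M) by (apply Rmult_le_compat_l; lra).
  assert (Tri : Rabs (c x * w x - b x * w1 x - eps * g x)
     <= Rabs (c x * w x) + Rabs (b x * w1 x) + eps * Rabs (g x)).
  { rewrite <- (Rabs_pos_eq eps) at 2 by lra. rewrite <- (Rabs_mult eps).
    unfold Rminus. eapply Rle_trans; [apply Rabs_triang|]. rewrite Rabs_Ropp.
    apply Rplus_le_compat_r. eapply Rle_trans; [apply Rabs_triang|]. rewrite Rabs_Ropp. lra. }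
  replace (eps * ((M * K1 + M * K0 + M) * (1 + E / (eps * eps))))
    with ((M * K1 + M * K0 + M) * (eps + eps * (E / (eps * eps)))) by ring.
  rewrite HE3. lra.
Qed.

(** * Bounds for the data and for the reduced solution *)

Lemma bounded_on_unit_interval (g : R -> R) :
  (forall x, 0 <= x <= 1 -> continuity_pt g x) ->
  exists M, forall x, 0 <= x <= 1 -> Rabs (g x) <= M.
Proof.
intros Hg.
destruct (continuity_ab_maj g 0 1 ltac:(lra) Hg) as [p [Hp _]].
destruct (continuity_ab_min g 0 1 ltac:(lra) Hg) as [q [Hq _]].
exists (Rabs (g p) + Rabs (g q)). intros x Hx.
specialize (Hp x Hx). specialize (Hq x Hx).
pose proof (Rle_abs (g p)). pose proof (Rle_abs (- g q)). rewrite Rabs_Ropp in H0.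
pose proof (Rabs_pos (g p)). pose proof (Rabs_pos (g q)).
apply Rabs_le; lra.
Qed.

Lemma C4_01_bounds (g : R -> R) :
  C4_01 g ->
  exists M, forall x, 0 <= x <= 1 ->
    is_derive g x (Derive g x) /\ is_derive (Derive g) x (Derive (Derive g) x) /\
    Rabs (g x) <= M /\ Rabs (Derive g x) <= M /\ Rabs (Derive (Derive g) x) <= M.
Proof.
intros Hg.
assert (D0 : forall x, 0 <= x <= 1 -> ex_derive g x).
{ intros x Hx. apply (proj1 (Hg x Hx) 1%nat); lia. }
assert (D1 : forall x, 0 <= x <= 1 -> ex_derive (Derive g) x).
{ intros x Hx. apply (proj1 (Hg x Hx) 2%nat); lia. }
assert (D2 : forall x, 0 <= x <= 1 -> ex_derive (Derive (Derive g)) x).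
{ intros x Hx. apply (proj1 (Hg x Hx) 3%nat); lia. }
destruct (bounded_on_unit_interval g) as [M0 H0].
{ intros x Hx. destruct (D0 x Hx) as [l Hl]. exact (is_derive_continuity_pt _ _ _ Hl). }
destruct (bounded_on_unit_interval (Derive g)) as [M1 H1].
{ intros x Hx. destruct (D1 x Hx) as [l Hl]. exact (is_derive_continuity_pt _ _ _ Hl). }
destruct (bounded_on_unit_interval (Derive (Derive g))) as [M2 H2].
{ intros x Hx. destruct (D2 x Hx) as [l Hl]. exact (is_derive_continuity_pt _ _ _ Hl). }
exists (Rmax M0 (Rmax M1 M2)). intros x Hx.
split; [apply Derive_correct, D0, Hx|]. split; [apply Derive_correct, D1, Hx|].
pose proof (Rmax_l M0 (Rmax M1 M2)). pose proof (Rmax_r M0 (Rmax M1 M2)).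
pose proof (Rmax_l M1 M2). pose proof (Rmax_r M1 M2).
specialize (H0 x Hx). specialize (H1 x Hx). specialize (H2 x Hx). lra.
Qed.

Lemma coef_bounds_weaken (beta delta M M' : R) (b b1 b2 c c1 c2 : R -> R) :
  M <= M' -> coef_bounds beta delta M b b1 b2 c c1 c2 ->
  coef_bounds beta delta M' b b1 b2 c c1 c2.
Proof.
intros HM [H1 H2 H3 D1 D2 D3 D4 L1 L2 B1 B2 B3 B4 B5 B6].
constructor; trivial; try lra;
  intros x Hx; apply Rle_trans with M; auto.
Qed.

Lemma C4_01_coef_bounds (b c : R -> R) (beta : R) :
  C4_01 b -> C4_01 c -> 0 < beta ->
  (forall x, 0 <= x <= 1 -> beta < b x) ->
  (forall x, 0 <= x <= 1 -> 0 <= c x) ->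
  exists delta M, coef_bounds beta delta M
    b (Derive b) (Derive (Derive b)) c (Derive c) (Derive (Derive c)).
Proof.
intros Hb Hc Hbeta Hlow Hc0.
destruct (C4_01_bounds b Hb) as [Mb Bb]. destruct (C4_01_bounds c Hc) as [Mc Bc].
destruct (continuity_ab_min b 0 1 ltac:(lra)) as [p [Hp Hp01]].
{ intros x Hx. apply (is_derive_continuity_pt _ _ (Derive b x)), Bb, Hx. }
exists (b p - beta), (Rmax 1 (Rmax Mb Mc)).
pose proof (Rmax_l 1 (Rmax Mb Mc)). pose proof (Rmax_r 1 (Rmax Mb Mc)).
pose proof (Rmax_l Mb Mc). pose proof (Rmax_r Mb Mc).
specialize (Hlow p Hp01).
constructor; trivial; try lra; intros x Hx;
  destruct (Bb x Hx) as (? & ? & ? & ? & ?); destruct (Bc x Hx) as (? & ? & ? & ? & ?);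
  trivial; try lra.
specialize (Hp x Hx); lra.
Qed.

Definition clamp (x : R) : R := Rmax 0 (Rmin x 1).

Lemma clamp_id (x : R) : 0 <= x <= 1 -> clamp x = x.
Proof. intros Hx. unfold clamp. rewrite Rmin_left, Rmax_right; lra. Qed.

Lemma clamp_locally_id (x : R) : 0 < x < 1 -> locally x (fun t => clamp t = t).
Proof.
intros Hx.
assert (Hd : 0 < Rmin x (1 - x)) by (apply Rmin_glb_lt; lra).
exists (mkposreal _ Hd). intros t Ht. apply clamp_id.
change (Rabs (t - x) < Rmin x (1 - x)) in Ht. apply Rabs_lt_between in Ht.
pose proof (Rmin_l x (1 - x)). pose proof (Rmin_r x (1 - x)). lra.
Qed.

(* [cont01] is one-sided at the end points, whereas [continuity_pt] is not. *)
Lemma continuity_pt_clamp (u : R -> R) (x : R) :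
  cont01 u -> 0 <= x <= 1 -> continuity_pt (fun t => u (clamp t)) x.
Proof.
intros Hu Hx. apply continuity_pt_filterlim. rewrite (clamp_id x Hx).
intros P HP. destruct (Hu x Hx P HP) as [d Hd].
exists d. intros t Ht. apply Hd.
- change (Rabs (t - x) < d) in Ht. change (Rabs (clamp t - x) < d).
  apply Rabs_lt_between in Ht. apply Rabs_lt_between.
  unfold clamp, Rmax, Rmin. destruct (Rle_dec t 1); destruct (Rle_dec 0 _); lra.
- unfold clamp, Rmax, Rmin. destruct (Rle_dec t 1); destruct (Rle_dec 0 _); lra.
Qed.

Lemma is_derive_clamp (u : R -> R) (x l : R) :
  0 < x < 1 -> is_derive u x l -> is_derive (fun t => u (clamp t)) x l.
Proof.
intros Hx. apply is_derive_ext_loc.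
destruct (clamp_locally_id x Hx) as [d Hd]. exists d. intros t Ht. now rewrite Hd.
Qed.

Lemma nonneg_at_0 (q : R -> R) :
  continuity_pt q 0 -> (forall x, 0 < x < 1 -> 0 <= q x) -> 0 <= q 0.
Proof.
intros Hc Hq. apply Rnot_lt_le; intros N.
destruct (Hc (- q 0) ltac:(lra)) as [d [Hd Hdq]].
set (t := Rmin (d / 2) (1 / 2)).
assert (Ht : 0 < t) by (apply Rmin_glb_lt; lra).
assert (Ht1 : t <= d / 2) by apply Rmin_l. assert (Ht2 : t <= 1 / 2) by apply Rmin_r.
specialize (Hq t ltac:(lra)).
assert (A : Rabs (q t - q 0) < - q 0).
{ apply (Hdq t). split; [split; [exact I|lra]|].
  change (Rabs (t - 0) < d). rewrite Rabs_pos_eq; lra. }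
apply Rabs_lt_between in A. lra.
Qed.

Lemma locally_unit_interval (x : R) : 0 < x < 1 -> locally x (fun t => 0 < t < 1).
Proof.
intros Hx. apply (locally_interval _ x 0 1); simpl; try lra. intros y; simpl; lra.
Qed.

(** Differentiating [n = b p] keeps [p] itself in the result. Bounds for successive derivatives of
    the reduced solution then follow from the earlier ones, with a single division by [b] each
    time. *)
Lemma is_derive_quotient (p n b : R -> R) (x n' b' : R) :
  locally x (fun t => p t = n t / b t) ->
  is_derive n x n' -> is_derive b x b' -> b x <> 0 ->
  is_derive p x ((n' - b' * p x) / b x).
Proof.
intros Hp Hn Hb H0. rewrite (locally_singleton _ _ Hp).
apply is_derive_ext_loc with (fun t => n t / b t).
{ apply filter_imp with (2 := Hp). intros t Ht. now symmetry. }
replace ((n' - b' * (n x / b x)) / b x) with ((n' * b x - n x * b') / b x ^ 2) by (field; exact H0).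
now apply is_derive_div.
Qed.

Lemma Rabs_div_le (beta y b A : R) : 0 < beta -> beta <= b -> Rabs y <= A -> Rabs (y / b) <= A / beta.
Proof.
intros Hbeta Hb Hy. unfold Rdiv. apply Rabs_mult_le; [exact Hy|].
rewrite Rabs_pos_eq by (left; apply Rinv_0_lt_compat; lra).
apply Rinv_le_contravar; lra.
Qed.

(** The size of [u0] comes from comparison with [K0 (1 - x)], going backward from [x = 1]. Each
    further derivative is obtained by differentiating [u0' = (c u0 - f) / b], and the Lipschitz
    bound for [u0''] is a bound for [u0''']. *)
Lemma reduced_solution_bounds (beta delta M : R) (b b1 b2 c c1 c2 f : R -> R) :
  coef_bounds beta delta M b b1 b2 c c1 c2 ->
  (forall x, 0 <= x <= 1 ->
    is_derive f x (Derive f x) /\ is_derive (Derive f) x (Derive (Derive f) x) /\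
    Rabs (f x) <= M /\ Rabs (Derive f x) <= M /\ Rabs (Derive (Derive f) x) <= M) ->
  exists K, forall u0, is_sol_u0 b c f u0 ->
    Rabs (u0 0) <= K /\
    (forall x, 0 < x < 1 -> is_derive (Derive u0) x (Derive (Derive u0) x)) /\
    (forall x, 0 < x < 1 -> Rabs (Derive (Derive u0) x) <= K) /\
    (forall x y, 0 < x < 1 -> 0 < y < 1 ->
       Rabs (Derive (Derive u0) x - Derive (Derive u0) y) <= K * Rabs (x - y)).
Proof.
intros CB Hf.
pose proof (cb_beta _ _ _ _ _ _ _ _ _ CB) as Hbeta.
pose proof (cb_delta _ _ _ _ _ _ _ _ _ CB) as Hdel.
pose proof (cb_M _ _ _ _ _ _ _ _ _ CB) as HM.
(* [K0] to [K3] bound [u0] and its first three derivatives. The summand 1 gives the strict sign that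
   [nonneg_backward] asks for. *)
set (K0 := M / beta + 1).
set (K1 := (M * K0 + M) / beta).
set (K2 := (M * K0 + M * K1 + M + M * K1) / beta).
set (K3 := (M * K0 + M * K1 + (M * K1 + M * K2) + M + (M * K1 + M * K2) + M * K2) / beta).
assert (P0 : 0 <= K0) by (assert (0 <= M / beta) by (apply Rdiv_le_0_compat; lra); unfold K0; lra).
assert (P1 : 0 <= K1) by (apply Rdiv_le_0_compat; nra).
assert (P2 : 0 <= K2) by (apply Rdiv_le_0_compat; nra).
exists (K0 + K2 + Rabs K3).
intros u0 (Hcont & H1 & Hu).
assert (Heq : forall x, 0 < x < 1 -> Derive u0 x = (c x * u0 x - f x) / b x).
{ intros x Hx. destruct (Hu x Hx) as [_ E].
  pose proof (cb_b_lower _ _ _ _ _ _ _ _ _ CB x ltac:(lra)).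
  replace (c x * u0 x - f x) with (b x * Derive u0 x) by lra. field. lra. }
pose (v := fun t => u0 (clamp t)).
assert (Dv : forall x, 0 < x < 1 -> is_derive v x (Derive u0 x)).
{ intros x Hx. apply is_derive_clamp, Derive_correct, Hu; trivial. }
assert (Cv : forall x, 0 <= x <= 1 -> continuity_pt v x).
{ intros x Hx. now apply continuity_pt_clamp. }
assert (V1 : v 1 = 0) by (unfold v; rewrite clamp_id; lra).
pose (l := fun t => K0 * (1 - t)).
assert (Dl : forall x, is_derive l x (- K0)) by (intros x; unfold l; auto_derive; [easy|ring]).
assert (Bv : forall x, 0 < x < 1 -> 0 <= l x - v x /\ 0 <= l x + v x).
{ intros x Hx. split.
  - apply (nonneg_backward (fun t => l t - v t) (fun t => - K0 - Derive u0 t) 1 x); try lra.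
    + intros z Hz. apply continuity_pt_minus; [exact (is_derive_continuity_pt _ _ _ (Dl z))|apply Cv; lra].
    + intros z Hz. apply (is_derive_minus l v); [apply Dl|apply Dv; lra].
    + intros z Hz Hneg. rewrite (Heq z ltac:(lra)).
      pose proof (cb_b_lower _ _ _ _ _ _ _ _ _ CB z ltac:(lra)) as Bz.
      pose proof (cb_c_lower _ _ _ _ _ _ _ _ _ CB z ltac:(lra)) as Cz.
      destruct (Hf z ltac:(lra)) as (_ & _ & Fz & _).
      assert (Hq : 0 <= c z * u0 z / b z).
      { apply Rdiv_le_0_compat; [|lra]. apply Rmult_le_pos; [lra|].
        unfold v in Hneg. rewrite clamp_id in Hneg by lra. unfold l in Hneg. nra. }
      apply (Rabs_div_le beta _ (b z)) in Fz; try lra. apply Rabs_le_between in Fz.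
      replace ((c z * u0 z - f z) / b z) with (c z * u0 z / b z - f z / b z) by (field; lra).
      unfold K0. lra.
    + unfold l; lra.
  - apply (nonneg_backward (fun t => l t + v t) (fun t => - K0 + Derive u0 t) 1 x); try lra.
    + intros z Hz. apply continuity_pt_plus; [exact (is_derive_continuity_pt _ _ _ (Dl z))|apply Cv; lra].
    + intros z Hz. apply (is_derive_plus l v); [apply Dl|apply Dv; lra].
    + intros z Hz Hneg. rewrite (Heq z ltac:(lra)).
      pose proof (cb_b_lower _ _ _ _ _ _ _ _ _ CB z ltac:(lra)) as Bz.
      pose proof (cb_c_lower _ _ _ _ _ _ _ _ _ CB z ltac:(lra)) as Cz.
      destruct (Hf z ltac:(lra)) as (_ & _ & Fz & _).
      assert (Hq : 0 <= c z * (- u0 z) / b z).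
      { apply Rdiv_le_0_compat; [|lra]. apply Rmult_le_pos; [lra|].
        unfold v in Hneg. rewrite clamp_id in Hneg by lra. unfold l in Hneg. nra. }
      apply (Rabs_div_le beta _ (b z)) in Fz; try lra. apply Rabs_le_between in Fz.
      replace ((c z * u0 z - f z) / b z) with (- (c z * (- u0 z) / b z) - f z / b z) by (field; lra).
      unfold K0. lra.
    + unfold l; lra. }
assert (Bu : forall x, 0 < x < 1 -> Rabs (u0 x) <= K0).
{ intros x Hx. destruct (Bv x Hx) as [A B]. unfold v, l in A, B. rewrite clamp_id in A, B by lra.
  apply Rabs_le; split; nra. }
assert (Bu0 : Rabs (u0 0) <= K0).
{ assert (E0 : v 0 = u0 0) by (unfold v; rewrite clamp_id; [easy|lra]).
  assert (A : 0 <= l 0 - v 0).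
  { apply (nonneg_at_0 (fun t => l t - v t)); [|intros x Hx; now apply Bv].
    apply continuity_pt_minus; [exact (is_derive_continuity_pt _ _ _ (Dl 0))|apply Cv; lra]. }
  assert (B : 0 <= l 0 + v 0).
  { apply (nonneg_at_0 (fun t => l t + v t)); [|intros x Hx; now apply Bv].
    apply continuity_pt_plus; [exact (is_derive_continuity_pt _ _ _ (Dl 0))|apply Cv; lra]. }
  unfold l in A, B. apply Rabs_le; split; lra. }
assert (Tri : forall s t A B, Rabs s <= A -> Rabs t <= B -> Rabs (s + t) <= A + B).
{ intros s t A B HA HB. eapply Rle_trans; [apply Rabs_triang|lra]. }
assert (TriM : forall s t A B, Rabs s <= A -> Rabs t <= B -> Rabs (s - t) <= A + B).
{ intros s t A B HA HB. apply Tri; [|rewrite Rabs_Ropp]; trivial. }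
assert (Bu1 : forall x, 0 < x < 1 -> Rabs (Derive u0 x) <= K1).
{ intros x Hx. rewrite Heq by trivial.
  pose proof (cb_b_lower _ _ _ _ _ _ _ _ _ CB x ltac:(lra)).
  apply Rabs_div_le; try lra. apply TriM; [apply Rabs_mult_le|apply Hf; lra].
  - apply (cb_c_bound _ _ _ _ _ _ _ _ _ CB); lra.
  - now apply Bu. }
assert (D2 : forall x, 0 < x < 1 -> is_derive (Derive u0) x
   ((c1 x * u0 x + c x * Derive u0 x - Derive f x - b1 x * Derive u0 x) / b x)).
{ intros x Hx. pose proof (cb_b_lower _ _ _ _ _ _ _ _ _ CB x ltac:(lra)).
  apply (is_derive_quotient (Derive u0) (fun t => c t * u0 t - f t) b x); [| | |lra].
  - apply filter_imp with (2 := locally_unit_interval x Hx). intros t Ht. now apply Heq.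
  - pose proof (cb_c1 _ _ _ _ _ _ _ _ _ CB x ltac:(lra)) as A.
    pose proof (Derive_correct _ _ (proj1 (Hu x Hx))) as B.
    pose proof (proj1 (Hf x ltac:(lra))) as F.
    apply (is_derive_minus (fun t => c t * u0 t) f); [|exact F].
    apply (is_derive_mult c u0); [exact A|exact B|intros; apply Rmult_comm].
  - apply (cb_b1 _ _ _ _ _ _ _ _ _ CB); lra. }
assert (Heq2 : forall x, 0 < x < 1 -> Derive (Derive u0) x =
   (c1 x * u0 x + c x * Derive u0 x - Derive f x - b1 x * Derive u0 x) / b x).
{ intros x Hx. now apply is_derive_unique, D2. }
assert (D2' : forall x, 0 < x < 1 -> is_derive (Derive u0) x (Derive (Derive u0) x)).
{ intros x Hx. rewrite Heq2 by trivial. now apply D2. }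
assert (Bu2 : forall x, 0 < x < 1 -> Rabs (Derive (Derive u0) x) <= K2).
{ intros x Hx. rewrite Heq2 by trivial.
  pose proof (cb_b_lower _ _ _ _ _ _ _ _ _ CB x ltac:(lra)).
  apply Rabs_div_le; try lra.
  apply TriM; [apply TriM; [apply Tri|]|]; try apply Rabs_mult_le; try now apply Bu1.
  - apply (cb_c1_bound _ _ _ _ _ _ _ _ _ CB); lra.
  - now apply Bu.
  - apply (cb_c_bound _ _ _ _ _ _ _ _ _ CB); lra.
  - apply Hf; lra.
  - apply (cb_b1_bound _ _ _ _ _ _ _ _ _ CB); lra. }
pose (n3 := fun x => (c2 x * u0 x + c1 x * Derive u0 x + (c1 x * Derive u0 x + c x * Derive (Derive u0) x)
    - Derive (Derive f) x - (b2 x * Derive u0 x + b1 x * Derive (Derive u0) x))).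
assert (D3 : forall x, 0 < x < 1 -> is_derive (Derive (Derive u0)) x
   ((n3 x - b1 x * Derive (Derive u0) x) / b x)).
{ intros x Hx. pose proof (cb_b_lower _ _ _ _ _ _ _ _ _ CB x ltac:(lra)).
  apply (is_derive_quotient (Derive (Derive u0))
    (fun t => c1 t * u0 t + c t * Derive u0 t - Derive f t - b1 t * Derive u0 t) b x); [| | |lra].
  - apply filter_imp with (2 := locally_unit_interval x Hx). intros t Ht. now apply Heq2.
  - pose proof (cb_c1 _ _ _ _ _ _ _ _ _ CB x ltac:(lra)) as A.
    pose proof (cb_c2 _ _ _ _ _ _ _ _ _ CB x ltac:(lra)) as A'.
    pose proof (cb_b2 _ _ _ _ _ _ _ _ _ CB x ltac:(lra)) as A''.
    pose proof (Derive_correct _ _ (proj1 (Hu x Hx))) as B.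
    destruct (Hf x ltac:(lra)) as (_ & F & _).
    apply (is_derive_minus (fun t => c1 t * u0 t + c t * Derive u0 t - Derive f t) (fun t => b1 t * Derive u0 t)).
    + apply (is_derive_minus (fun t => c1 t * u0 t + c t * Derive u0 t) (Derive f)); [|exact F].
      apply (is_derive_plus (fun t => c1 t * u0 t) (fun t => c t * Derive u0 t)).
      * apply (is_derive_mult c1 u0); [exact A'|exact B|intros; apply Rmult_comm].
      * apply (is_derive_mult c (Derive u0)); [exact A|now apply D2'|intros; apply Rmult_comm].
    + apply (is_derive_mult b1 (Derive u0)); [exact A''|now apply D2'|intros; apply Rmult_comm].
  - apply (cb_b1 _ _ _ _ _ _ _ _ _ CB); lra. }
assert (Bu3 : forall x, 0 < x < 1 -> Rabs ((n3 x - b1 x * Derive (Derive u0) x) / b x) <= K3).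
{ intros x Hx. pose proof (cb_b_lower _ _ _ _ _ _ _ _ _ CB x ltac:(lra)).
  apply Rabs_div_le; try lra. unfold n3.
  repeat (first [apply TriM | apply Tri | apply Rabs_mult_le]);
    try (now apply Bu); try (now apply Bu1); try (now apply Bu2); try (apply Hf; lra).
  - apply (cb_c2_bound _ _ _ _ _ _ _ _ _ CB); lra.
  - apply (cb_c1_bound _ _ _ _ _ _ _ _ _ CB); lra.
  - apply (cb_c1_bound _ _ _ _ _ _ _ _ _ CB); lra.
  - apply (cb_c_bound _ _ _ _ _ _ _ _ _ CB); lra.
  - apply (cb_b2_bound _ _ _ _ _ _ _ _ _ CB); lra.
  - apply (cb_b1_bound _ _ _ _ _ _ _ _ _ CB); lra.
  - apply (cb_b1_bound _ _ _ _ _ _ _ _ _ CB); lra. }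
pose proof (Rabs_pos K3) as PK3. pose proof (Rle_abs K3) as LK3.
split; [lra|]. split; [exact D2'|]. split.
- intros x Hx. specialize (Bu2 x Hx). lra.
- assert (G : forall s t, 0 < s -> s < t -> t < 1 ->
    Rabs (Derive (Derive u0) t - Derive (Derive u0) s) <= (K0 + K2 + Rabs K3) * Rabs (t - s)).
  { intros s t Hs Hst Ht.
    destruct (mvt_open (Derive (Derive u0)) (fun z => (n3 z - b1 z * Derive (Derive u0) z) / b z) s t Hst) as [r [Hr Er]].
    - intros z Hz. apply (is_derive_continuity_pt _ _ _ (D3 z ltac:(lra))).
    - intros z Hz; apply D3; lra.
    - rewrite Er. apply Rabs_mult_le; [|lra]. specialize (Bu3 r ltac:(lra)). lra. }
  intros x y Hx Hy. destruct (Rtotal_order x y) as [L|[E|L]].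
  + rewrite Rabs_minus_sym, (Rabs_minus_sym x). apply G; lra.
  + rewrite E. unfold Rminus; rewrite !Rplus_opp_r, Rabs_R0. lra.
  + apply G; lra.
Qed.

Lemma layer_problem_of_solutions (K eps : R) (b c f u u0 : R -> R) :
  0 < eps < 1 ->
  is_sol_u eps b c f u -> is_sol_u0 b c f u0 ->
  Rabs (u0 0) <= K ->
  (forall x, 0 < x < 1 -> is_derive (Derive u0) x (Derive (Derive u0) x)) ->
  (forall x, 0 < x < 1 -> Rabs (Derive (Derive u0) x) <= K) ->
  (forall x y, 0 < x < 1 -> 0 < y < 1 ->
     Rabs (Derive (Derive u0) x - Derive (Derive u0) y) <= K * Rabs (x - y)) ->
  layer_problem K eps b c (Derive (Derive u0))
    (fun t => u (clamp t) - u0 (clamp t))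
    (fun t => Derive u t - Derive u0 t)
    (fun t => Derive (Derive u) t - Derive (Derive u0) t).
Proof.
intros He (Cu & U0 & U1 & Hu) (Cu0 & V1 & Hu0) B0 D2 B2 L2.
constructor; trivial.
- intros x Hx. apply continuity_pt_minus; now apply continuity_pt_clamp.
- intros x Hx. destruct (Hu x Hx) as [E _]. destruct (Hu0 x Hx) as [E0 _].
  apply (is_derive_minus (fun t => u (clamp t)) (fun t => u0 (clamp t)));
    apply is_derive_clamp; trivial; now apply Derive_correct.
- intros x Hx. destruct (Hu x Hx) as [_ [E _]].
  apply (is_derive_minus (Derive u) (Derive u0)); [now apply Derive_correct|now apply D2].
- intros x Hx. destruct (Hu x Hx) as (_ & _ & E). destruct (Hu0 x Hx) as [_ E0].
  rewrite clamp_id by lra. lra.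
- rewrite clamp_id, U0 by lra. unfold Rminus. now rewrite Rplus_0_l, Rabs_Ropp.
- rewrite clamp_id by lra. lra.
Qed.

(** * Truncation errors of the scheme at the layer function *)

Lemma mvt_abs_bound (p p1 : R -> R) (l r A x z : R) :
  (forall t, l < t < r -> is_derive p t (p1 t)) ->
  (forall t, l < t < r -> Rabs (p1 t) <= A) ->
  l < x < r -> l < z < r ->
  Rabs (p z - p x) <= A * Rabs (z - x).
Proof.
intros Hd Hb Hx Hz.
assert (G : forall s t, l < s -> s < t -> t < r -> Rabs (p t - p s) <= A * Rabs (t - s)).
{ intros s t Hs Hst Ht. destruct (mvt_open p p1 s t Hst) as [q [Hq E]].
  - intros y Hy. apply (is_derive_continuity_pt _ _ (p1 y)), Hd; lra.
  - intros y Hy; apply Hd; lra.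
  - rewrite E. apply Rabs_mult_le; [apply Hb|]; lra. }
destruct (Rtotal_order x z) as [L|[E|L]].
- apply G; lra.
- rewrite E. unfold Rminus; rewrite !Rplus_opp_r, Rabs_R0. lra.
- rewrite Rabs_minus_sym, (Rabs_minus_sym z). apply G; lra.
Qed.

(** Two mean value steps give [A] where Taylor's formula has [A / 2], and they use nothing about
    [p2] but its bound. *)
Lemma taylor_abs_bound (p p1 p2 : R -> R) (l r A x z : R) :
  (forall t, l < t < r -> is_derive p t (p1 t)) ->
  (forall t, l < t < r -> is_derive p1 t (p2 t)) ->
  (forall t, l < t < r -> Rabs (p2 t) <= A) ->
  l < x < r -> l < z < r ->
  Rabs (p z - p x - p1 x * (z - x)) <= A * (z - x) ^ 2.
Proof.
intros Hd1 Hd2 Hb Hx Hz.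
destruct (Req_dec x z) as [E|E].
{ rewrite E. replace (p z - p z - p1 z * (z - z)) with 0 by ring. rewrite Rabs_R0. lra. }
assert (G : exists q, Rmin x z < q < Rmax x z /\ p z - p x = p1 q * (z - x)).
{ destruct (Rlt_dec x z) as [L|L].
  - rewrite Rmin_left, Rmax_right by lra. apply mvt_open; [lra| |].
    + intros y Hy. apply (is_derive_continuity_pt _ _ (p1 y)), Hd1; lra.
    + intros y Hy; apply Hd1; lra.
  - rewrite Rmin_right, Rmax_left by lra.
    destruct (mvt_open p p1 z x ltac:(lra)) as [q [Hq Eq]].
    + intros y Hy. apply (is_derive_continuity_pt _ _ (p1 y)), Hd1; lra.
    + intros y Hy; apply Hd1; lra.
    + exists q. split; [exact Hq|lra]. }
destruct G as [q [Hq Eq]].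
assert (Hqlr : l < q < r /\ Rabs (q - x) <= Rabs (z - x)).
{ unfold Rmin, Rmax in Hq. destruct (Rle_dec x z).
  - rewrite !Rabs_pos_eq; lra.
  - rewrite !Rabs_left; lra. }
replace (p z - p x - p1 x * (z - x)) with ((p1 q - p1 x) * (z - x)) by lra.
replace (A * (z - x) ^ 2) with (A * Rabs (z - x) * Rabs (z - x)).
2: { rewrite <- (pow2_abs (z - x)). ring. }
apply Rabs_mult_le; [|lra].
apply Rle_trans with (A * Rabs (q - x)).
- now apply (mvt_abs_bound p1 p2 l r).
- apply Rmult_le_compat_l; [|lra].
  apply Rle_trans with (Rabs (p2 x)); [apply Rabs_pos|auto].
Qed.

Definition layer_bounded (K beta eps : R) (w w1 w2 : R -> R) : Prop :=
  forall x, 0 < x < 1 ->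
  Rabs (w x) <= K * (eps + exp (- beta * x / eps)) /\
  Rabs (w1 x) <= K * (eps + exp (- beta * x / eps) / eps) /\
  Rabs (w2 x) <= K * (1 + exp (- beta * x / eps) / (eps * eps)).

(** Up to the factor [K] this is the bound for [w''] at [y], and [eps] times it bounds [w] and [w'].
    It decreases in [y], so its value at the left node of a stencil serves for the whole stencil. *)
Definition layer_weight (beta eps y : R) : R := 1 + exp (- beta * y / eps) / (eps * eps).

Lemma layer_weight_bounds (K beta eps y x : R) (w w1 w2 : R -> R) :
  0 < eps < 1 -> 0 < beta -> 0 <= K -> layer_bounded K beta eps w w1 w2 ->
  y <= x -> 0 < x < 1 ->
  Rabs (w x) <= K * (eps * layer_weight beta eps y) /\
  Rabs (w1 x) <= K * (eps * layer_weight beta eps y) /\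
  Rabs (w2 x) <= K * layer_weight beta eps y.
Proof.
intros He Hbeta HK HB Hyx Hx. unfold layer_weight.
destruct (HB x Hx) as (B0 & B1 & B2).
assert (Hexp : exp (- beta * x / eps) <= exp (- beta * y / eps)).
{ apply exp_nondecreasing. apply Rmult_le_reg_r with eps; [lra|]. field_simplify; nra. }
set (E := exp (- beta * y / eps)) in *.
pose proof (exp_pos (- beta * x / eps)) as HE.
assert (HEp : 0 < E) by lra.
assert (Hi : 1 <= / eps) by (rewrite <- Rinv_1; apply Rinv_le_contravar; lra).
assert (H1 : exp (- beta * x / eps) / eps <= E / eps).
{ apply Rmult_le_compat_r; lra. }
assert (H2 : exp (- beta * x / eps) / (eps * eps) <= E / (eps * eps)).
{ apply Rmult_le_compat_r; [left; apply Rinv_0_lt_compat; nra|lra]. }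
assert (H0 : E <= E / eps) by (unfold Rdiv; nra).
replace (eps * (1 + E / (eps * eps))) with (eps + E / eps) by (field; lra).
split; [|split]; eapply Rle_trans; eauto; apply Rmult_le_compat_l; lra.
Qed.

Lemma layer_weight_ge_1 (beta eps y : R) : 0 < eps -> 1 <= layer_weight beta eps y.
Proof.
intros He. unfold layer_weight.
assert (0 <= exp (- beta * y / eps) / (eps * eps)).
{ apply Rdiv_le_0_compat; [left; apply exp_pos|nra]. }
lra.
Qed.

Lemma truncation_second_order (beta delta M K eps x h : R)
  (b b1 b2 c c1 c2 g w w1 w2 : R -> R) :
  coef_bounds beta delta M b b1 b2 c c1 c2 ->
  layer_problem M eps b c g w w1 w2 ->
  0 <= K -> layer_bounded K beta eps w w1 w2 ->
  0 < h -> 0 <= x - h -> x + h <= 1 ->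
  Rabs (asi_stencil eps (b x) h (w (x - h)) (w x) (w (x + h)) + c x * w x - eps * g x)
    <= (6 * (M * K) + M * (M * K)) * (h * h * layer_weight beta eps (x - h)) + M * (eps * h).
Proof.
intros CB LP HK HB Hh Hl Hr.
pose proof (lp_eps _ _ _ _ _ _ _ _ LP) as He.
pose proof (cb_beta _ _ _ _ _ _ _ _ _ CB) as Hbeta.
pose proof (cb_delta _ _ _ _ _ _ _ _ _ CB) as Hdel.
pose proof (cb_M _ _ _ _ _ _ _ _ _ CB) as HM.
assert (Hx : 0 < x < 1) by lra.
pose proof (cb_b_lower _ _ _ _ _ _ _ _ _ CB x ltac:(lra)) as Bx.
set (A := layer_weight beta eps (x - h)).
assert (HA : 1 <= A) by (apply layer_weight_ge_1; lra).
assert (HW : forall z, x - h < z < x + h ->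
  Rabs (w z) <= K * (eps * A) /\ Rabs (w1 z) <= K * (eps * A) /\ Rabs (w2 z) <= K * A).
{ intros z Hz. apply (layer_weight_bounds K beta eps (x - h) z w w1 w2); trivial; lra. }
assert (HepsA : eps * A <= A) by nra.
assert (HKA : K * (eps * A) <= K * A) by (apply Rmult_le_compat_l; lra).
assert (HKA0 : 0 <= K * A) by nra.
(* This is the derivative at [x] of [- c w + (b - b x) w']. It contains no [w''], so it is of order
   [eps * A], and this [eps] cancels the denominator of the first moment. The term [eps * g] is not
   expanded; it is left to the remainder. *)
set (gam := - (c1 x * w x + c x * w1 x) + b1 x * w1 x).
destruct (HW x ltac:(lra)) as (Wx & W1x & W2x).
assert (Hgam : Rabs gam <= 3 * (M * (K * (eps * A)))).
{ pose proof (Rabs_mult_le _ _ _ _ (cb_c1_bound _ _ _ _ _ _ _ _ _ CB x ltac:(lra)) Wx) as A1.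
  pose proof (Rabs_mult_le _ _ _ _ (cb_c_bound _ _ _ _ _ _ _ _ _ CB x ltac:(lra)) W1x) as A2.
  pose proof (Rabs_mult_le _ _ _ _ (cb_b1_bound _ _ _ _ _ _ _ _ _ CB x ltac:(lra)) W1x) as A3.
  apply Rabs_le_between in A1. apply Rabs_le_between in A2. apply Rabs_le_between in A3.
  unfold gam. apply Rabs_le; lra. }
replace (asi_stencil eps (b x) h (w (x - h)) (w x) (w (x + h)) + c x * w x - eps * g x)
  with (asi_stencil eps (b x) h (w (x - h)) (w x) (w (x + h)) - (eps * g x - c x * w x)) by ring.
eapply Rle_trans.
- apply (asi_stencil_consistency eps (b x) h x (eps * g x - c x * w x) gam
    (eps * (M * h) + 4 * (M * (K * A)) * (h * h) + M * h * (K * A * h) + M * (h * h) * (K * A)) w w1 w2); try lra.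
  + intros z Hz. apply (lp_cont _ _ _ _ _ _ _ _ LP); lra.
  + intros z Hz. apply (lp_w1 _ _ _ _ _ _ _ _ LP); lra.
  + intros z Hz. apply (lp_w2 _ _ _ _ _ _ _ _ LP); lra.
  + intros z Hz. pose proof (lp_eq _ _ _ _ _ _ _ _ LP z ltac:(lra)) as Eq.
    (* The product [(b z - b x) * w1 z], less its linear part, is split so that only [b] is expanded
       to second order. For [w1] a first difference is enough, which [w2] controls. *)
    replace (- eps * w2 z - b x * w1 z - (eps * g x - c x * w x) - gam * (z - x))
    with (eps * (g z - g x)
      - (c z * w z - c x * w x - (c1 x * w x + c x * w1 x) * (z - x))
      + (b z - b x) * (w1 z - w1 x) + (b z - b x - b1 x * (z - x)) * w1 x)
    by (unfold gam; lra).
    assert (Hzx : Rabs (z - x) <= h) by (apply Rabs_le; lra).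
    assert (Hzx2 : (z - x) ^ 2 <= h * h).
    { rewrite <- (pow2_abs (z - x)). pose proof (Rabs_pos (z - x)). nra. }
    assert (T1 : Rabs (eps * (g z - g x)) <= eps * (M * h)).
    { apply Rabs_mult_le; [rewrite Rabs_pos_eq; lra|].
      eapply Rle_trans; [apply (lp_g_lip _ _ _ _ _ _ _ _ LP); lra|].
      apply Rmult_le_compat_l; lra. }
    assert (T2 : Rabs (c z * w z - c x * w x - (c1 x * w x + c x * w1 x) * (z - x))
      <= 4 * (M * (K * A)) * (h * h)).
    { apply Rle_trans with (4 * (M * (K * A)) * (z - x) ^ 2);
        [|apply Rmult_le_compat_l; [nra|exact Hzx2]].
      apply (taylor_abs_bound (fun t => c t * w t) (fun t => c1 t * w t + c t * w1 t)
       (fun t => (c2 t * w t + c1 t * w1 t) + (c1 t * w1 t + c t * w2 t)) (x - h) (x + h)); try lra.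
      - intros t Ht. apply (is_derive_mult c w);
          [apply (cb_c1 _ _ _ _ _ _ _ _ _ CB); lra|apply (lp_w1 _ _ _ _ _ _ _ _ LP); lra|intros; apply Rmult_comm].
      - intros t Ht. apply (is_derive_plus (fun t => c1 t * w t) (fun t => c t * w1 t)).
        + apply (is_derive_mult c1 w);
          [apply (cb_c2 _ _ _ _ _ _ _ _ _ CB); lra|apply (lp_w1 _ _ _ _ _ _ _ _ LP); lra|intros; apply Rmult_comm].
        + apply (is_derive_mult c w1);
          [apply (cb_c1 _ _ _ _ _ _ _ _ _ CB); lra|apply (lp_w2 _ _ _ _ _ _ _ _ LP); lra|intros; apply Rmult_comm].
      - intros t Ht. destruct (HW t Ht) as (Wt & W1t & W2t).
        pose proof (Rabs_mult_le _ _ _ _ (cb_c2_bound _ _ _ _ _ _ _ _ _ CB t ltac:(lra)) (Rle_trans _ _ _ Wt HKA)) as A1.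
        pose proof (Rabs_mult_le _ _ _ _ (cb_c1_bound _ _ _ _ _ _ _ _ _ CB t ltac:(lra)) (Rle_trans _ _ _ W1t HKA)) as A2.
        pose proof (Rabs_mult_le _ _ _ _ (cb_c_bound _ _ _ _ _ _ _ _ _ CB t ltac:(lra)) W2t) as A3.
        apply Rabs_le_between in A1. apply Rabs_le_between in A2. apply Rabs_le_between in A3.
        apply Rabs_le; lra. }
    assert (T3 : Rabs ((b z - b x) * (w1 z - w1 x)) <= M * h * (K * A * h)).
    { apply Rabs_mult_le.
      - apply Rle_trans with (M * Rabs (z - x)); [|apply Rmult_le_compat_l; lra].
        apply (mvt_abs_bound b b1 (x - h) (x + h)); try lra; intros t Ht.
        + apply (cb_b1 _ _ _ _ _ _ _ _ _ CB); lra.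
        + apply (cb_b1_bound _ _ _ _ _ _ _ _ _ CB); lra.
      - apply Rle_trans with (K * A * Rabs (z - x)); [|apply Rmult_le_compat_l; lra].
        apply (mvt_abs_bound w1 w2 (x - h) (x + h)); try lra; intros t Ht.
        + apply (lp_w2 _ _ _ _ _ _ _ _ LP); lra.
        + now apply HW. }
    assert (T4 : Rabs ((b z - b x - b1 x * (z - x)) * w1 x) <= M * (h * h) * (K * A)).
    { apply Rabs_mult_le; [|lra].
      apply Rle_trans with (M * (z - x) ^ 2); [|apply Rmult_le_compat_l; lra].
      apply (taylor_abs_bound b b1 b2 (x - h) (x + h)); try lra; intros t Ht.
      - apply (cb_b1 _ _ _ _ _ _ _ _ _ CB); lra.
      - apply (cb_b2 _ _ _ _ _ _ _ _ _ CB); lra.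
      - apply (cb_b2_bound _ _ _ _ _ _ _ _ _ CB); lra. }
    apply Rabs_le_between in T1. apply Rabs_le_between in T2.
    apply Rabs_le_between in T3. apply Rabs_le_between in T4.
    apply Rabs_le; lra.
- assert (Hm : Rabs gam * (b x * (h * h) / (4 * eps)) <= M * (M * K) * (h * h * A)).
  { pose proof (cb_b_bound _ _ _ _ _ _ _ _ _ CB x ltac:(lra)) as BM. apply Rabs_le_between in BM.
    assert (0 <= h * h / (4 * eps)) by (apply Rdiv_le_0_compat; nra).
    assert (Hbh : b x * (h * h) / (4 * eps) <= M * (h * h / (4 * eps))).
    { replace (b x * (h * h) / (4 * eps)) with (b x * (h * h / (4 * eps))) by (field; lra).
      apply Rmult_le_compat_r; lra. }
    apply Rle_trans with (3 * (M * (K * (eps * A))) * (M * (h * h / (4 * eps)))).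
    - apply Rmult_le_compat; trivial; [apply Rabs_pos|apply Rdiv_le_0_compat; nra].
    - replace (3 * (M * (K * (eps * A))) * (M * (h * h / (4 * eps))))
        with (3 / 4 * (M * (M * K) * (h * h * A))) by (field; lra).
      assert (0 <= M * (M * K) * (h * h * A)).
      { apply Rmult_le_pos; [apply Rmult_le_pos; [lra|nra]|nra]. }
      lra. }
  lra.
Qed.

(** Once [h] exceeds [eps], the moment [h^2 / eps] is larger than [h] and the expansion brings no
    gain. Hence [gam] is 0 here, and the oscillation bound keeps its factor [eps]. *)
Lemma truncation_first_order (beta delta M K eps x h : R)
  (b b1 b2 c c1 c2 g w w1 w2 : R -> R) :
  coef_bounds beta delta M b b1 b2 c c1 c2 ->
  layer_problem M eps b c g w w1 w2 ->
  0 <= K -> layer_bounded K beta eps w w1 w2 ->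
  0 < h -> 0 <= x - h -> x + h <= 1 ->
  Rabs (asi_stencil eps (b x) h (w (x - h)) (w x) (w (x + h)) + c x * w x - eps * g x)
    <= (M + 3 * (M * (K * layer_weight beta eps (x - h)))) * (eps * h).
Proof.
intros CB LP HK HB Hh Hl Hr.
pose proof (lp_eps _ _ _ _ _ _ _ _ LP) as He.
pose proof (cb_beta _ _ _ _ _ _ _ _ _ CB) as Hbeta.
pose proof (cb_delta _ _ _ _ _ _ _ _ _ CB) as Hdel.
pose proof (cb_M _ _ _ _ _ _ _ _ _ CB) as HM.
assert (Hx : 0 < x < 1) by lra.
pose proof (cb_b_lower _ _ _ _ _ _ _ _ _ CB x ltac:(lra)) as Bx.
set (A := layer_weight beta eps (x - h)).
assert (HA : 1 <= A) by (apply layer_weight_ge_1; lra).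
assert (HW : forall z, x - h < z < x + h ->
  Rabs (w z) <= K * (eps * A) /\ Rabs (w1 z) <= K * (eps * A) /\ Rabs (w2 z) <= K * A).
{ intros z Hz. apply (layer_weight_bounds K beta eps (x - h) z w w1 w2); trivial; lra. }
replace (asi_stencil eps (b x) h (w (x - h)) (w x) (w (x + h)) + c x * w x - eps * g x)
  with (asi_stencil eps (b x) h (w (x - h)) (w x) (w (x + h)) - (eps * g x - c x * w x)) by ring.
eapply Rle_trans.
- apply (asi_stencil_consistency eps (b x) h x (eps * g x - c x * w x) 0
    (eps * (M * h) + 2 * (M * (K * (eps * A))) * h + M * h * (K * (eps * A))) w w1 w2); try lra.
  + intros z Hz. apply (lp_cont _ _ _ _ _ _ _ _ LP); lra.
  + intros z Hz. apply (lp_w1 _ _ _ _ _ _ _ _ LP); lra.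
  + intros z Hz. apply (lp_w2 _ _ _ _ _ _ _ _ LP); lra.
  + intros z Hz. pose proof (lp_eq _ _ _ _ _ _ _ _ LP z ltac:(lra)) as Eq.
    replace (- eps * w2 z - b x * w1 z - (eps * g x - c x * w x) - 0 * (z - x))
    with (eps * (g z - g x) - (c z * w z - c x * w x) + (b z - b x) * w1 z) by lra.
    assert (Hzx : Rabs (z - x) <= h) by (apply Rabs_le; lra).
    assert (HKA0 : 0 <= K * (eps * A)) by (repeat apply Rmult_le_pos; lra).
    assert (T1 : Rabs (eps * (g z - g x)) <= eps * (M * h)).
    { apply Rabs_mult_le; [rewrite Rabs_pos_eq; lra|].
      eapply Rle_trans; [apply (lp_g_lip _ _ _ _ _ _ _ _ LP); lra|].
      apply Rmult_le_compat_l; lra. }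
    assert (T2 : Rabs (c z * w z - c x * w x) <= 2 * (M * (K * (eps * A))) * h).
    { apply Rle_trans with (2 * (M * (K * (eps * A))) * Rabs (z - x));
        [|apply Rmult_le_compat_l; [nra|exact Hzx]].
      apply (mvt_abs_bound (fun t => c t * w t) (fun t => c1 t * w t + c t * w1 t) (x - h) (x + h)); try lra.
      - intros t Ht. apply (is_derive_mult c w);
          [apply (cb_c1 _ _ _ _ _ _ _ _ _ CB); lra|apply (lp_w1 _ _ _ _ _ _ _ _ LP); lra|intros; apply Rmult_comm].
      - intros t Ht. destruct (HW t Ht) as (Wt & W1t & W2t).
        pose proof (Rabs_mult_le _ _ _ _ (cb_c1_bound _ _ _ _ _ _ _ _ _ CB t ltac:(lra)) Wt) as A1.
        pose proof (Rabs_mult_le _ _ _ _ (cb_c_bound _ _ _ _ _ _ _ _ _ CB t ltac:(lra)) W1t) as A2.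
        apply Rabs_le_between in A1. apply Rabs_le_between in A2.
        apply Rabs_le; lra. }
    assert (T3 : Rabs ((b z - b x) * w1 z) <= M * h * (K * (eps * A))).
    { apply Rabs_mult_le; [|now apply HW].
      apply Rle_trans with (M * Rabs (z - x)); [|apply Rmult_le_compat_l; lra].
      apply (mvt_abs_bound b b1 (x - h) (x + h)); try lra; intros t Ht.
      + apply (cb_b1 _ _ _ _ _ _ _ _ _ CB); lra.
      + apply (cb_b1_bound _ _ _ _ _ _ _ _ _ CB); lra. }
    apply Rabs_le_between in T1. apply Rabs_le_between in T2.
    apply Rabs_le_between in T3. apply Rabs_le; lra.
- rewrite Rabs_R0. lra.
Qed.

Lemma truncation_crude (beta delta M K eps : R) (x : nat -> R) (n : nat)
  (b b1 b2 c c1 c2 g w w1 w2 : R -> R) :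
  coef_bounds beta delta M b b1 b2 c c1 c2 ->
  layer_problem M eps b c g w w1 w2 ->
  0 <= K -> layer_bounded K beta eps w w1 w2 ->
  0 <= x n -> x n < x (S n) -> x (S n) < x (S (S n)) -> x (S (S n)) <= 1 ->
  Rabs (LN eps b c x (fun i => w (x i)) (S n) - eps * g (x (S n)))
    <= (2 * (K * layer_weight beta eps (x n)) + 2 * (M * (K * layer_weight beta eps (x n))) + M) * eps.
Proof.
intros CB LP HK HB X0 X1 X2 X3.
pose proof (lp_eps _ _ _ _ _ _ _ _ LP) as He.
pose proof (cb_beta _ _ _ _ _ _ _ _ _ CB) as Hbeta.
pose proof (cb_delta _ _ _ _ _ _ _ _ _ CB) as Hdel.
rewrite LN_S.
set (xm := x n) in *. set (xc := x (S n)) in *. set (xp := x (S (S n))) in *.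
set (A := layer_weight beta eps xm).
assert (HA : 1 <= A) by (apply layer_weight_ge_1; lra).
assert (HW : forall z, xm < z < xp ->
  Rabs (w z) <= K * (eps * A) /\ Rabs (w1 z) <= K * (eps * A) /\ Rabs (w2 z) <= K * A).
{ intros z Hz. apply (layer_weight_bounds K beta eps xm z w w1 w2); trivial; lra. }
destruct (mvt_open w w1 xm xc) as [q [Hq Eq]]; [lra| | |].
{ intros z Hz; apply (lp_cont _ _ _ _ _ _ _ _ LP); lra. }
{ intros z Hz; apply (lp_w1 _ _ _ _ _ _ _ _ LP); lra. }
destruct (mvt_open w w1 xc xp) as [p [Hp Ep]]; [lra| | |].
{ intros z Hz; apply (lp_cont _ _ _ _ _ _ _ _ LP); lra. }
{ intros z Hz; apply (lp_w1 _ _ _ _ _ _ _ _ LP); lra. }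
rewrite Ep, Eq.
replace (w1 p * (xp - xc) / (xp - xc)) with (w1 p) by (field; lra).
replace (w1 q * (xc - xm) / (xc - xm)) with (w1 q) by (field; lra).
set (s := sigma _).
pose proof (cb_b_lower _ _ _ _ _ _ _ _ _ CB xc ltac:(lra)) as Bx.
assert (Hs : 0 < s <= 1).
{ apply sigma_bounds. apply Rdiv_lt_0_compat; [apply Rmult_lt_0_compat|]; lra. }
assert (T1 : Rabs (eps * s * ((w1 p - w1 q) / ((xc - xm + (xp - xc)) / 2))) <= eps * 1 * (2 * (K * A))).
{ apply Rabs_mult_le; [rewrite Rabs_pos_eq; nra|].
  assert (L : Rabs (w1 p - w1 q) <= K * A * (xp - xm)).
  { apply Rle_trans with (K * A * Rabs (p - q)).
    - apply (mvt_abs_bound w1 w2 xm xp); try lra; intros t Ht.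
      + apply (lp_w2 _ _ _ _ _ _ _ _ LP); lra.
      + now apply HW.
    - apply Rmult_le_compat_l; [nra|]. rewrite Rabs_pos_eq; lra. }
  replace ((xc - xm + (xp - xc)) / 2) with ((xp - xm) / 2) by field.
  replace ((w1 p - w1 q) / ((xp - xm) / 2)) with ((w1 p - w1 q) * (2 / (xp - xm))) by (field; lra).
  replace (2 * (K * A)) with (K * A * (xp - xm) * (2 / (xp - xm))) by (field; lra).
  apply Rabs_mult_le; [exact L|].
  rewrite Rabs_pos_eq; [lra|]. apply Rdiv_le_0_compat; lra. }
pose proof (Rabs_mult_le _ _ _ _ (cb_b_bound _ _ _ _ _ _ _ _ _ CB xc ltac:(lra))
  (proj1 (proj2 (HW p ltac:(lra))))) as T2.
pose proof (Rabs_mult_le _ _ _ _ (cb_c_bound _ _ _ _ _ _ _ _ _ CB xc ltac:(lra))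
  (proj1 (HW xc ltac:(lra)))) as T3.
pose proof (lp_g_bound _ _ _ _ _ _ _ _ LP xc ltac:(lra)) as T4.
apply Rabs_le_between in T1. apply Rabs_le_between in T2.
apply Rabs_le_between in T3. apply Rabs_le_between in T4.
apply Rabs_le; split; nra.
Qed.

(** * Error estimate on a mesh with one change of step *)

Lemma LN_uniform (eps h : R) (b c w : R -> R) (x : nat -> R) (n : nat) :
  0 < h -> x (S n) = x n + h -> x (S (S n)) = x (S n) + h ->
  LN eps b c x (fun i => w (x i)) (S n) =
  asi_stencil eps (b (x (S n))) h (w (x (S n) - h)) (w (x (S n))) (w (x (S n) + h))
  + c (x (S n)) * w (x (S n)).
Proof.
intros Hh E1 E2. rewrite LN_S.
replace (x (S n) - h) with (x n) by lra.
replace (x (S n) + h) with (x (S (S n))) by lra.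
replace (x (S (S n)) - x (S n)) with h by lra.
replace (x (S n) - x n) with h by lra.
replace ((h + h) / 2) with h by field.
reflexivity.
Qed.

Lemma nondecreasing_steps (x : nat -> R) (N i j : nat) :
  (forall n, (n < N)%nat -> x n < x (S n)) -> (i <= j)%nat -> (j <= N)%nat -> x i <= x j.
Proof.
intros Hx Hij. induction Hij as [|j Hij IH]; intros Hj; [lra|].
specialize (IH ltac:(lia)). specialize (Hx j ltac:(lia)). lra.
Qed.

(* The rectangle rule for [e^(-t)] on a step [t = beta h / eps], evaluated at the left end,
   exceeds the integral at most by the factor [1 + t]. *)
Lemma exp_step_telescope (beta eps h y : R) :
  0 < beta -> 0 < eps -> 0 < h ->
  h * exp (- beta * y / eps)
    <= (h + eps / beta) * (exp (- beta * y / eps) - exp (- beta * (y + h) / eps)).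
Proof.
intros Hb He Hh. set (t := beta * h / eps).
assert (Ht : 0 < t) by (apply Rdiv_lt_0_compat; nra).
replace (- beta * (y + h) / eps) with (- beta * y / eps + - t) by (unfold t; field; lra).
rewrite exp_plus. set (E := exp (- beta * y / eps)).
assert (HE : 0 < E) by apply exp_pos.
assert (Hh' : h = eps / beta * t) by (unfold t; field; lra).
assert (Hq : 0 < eps / beta) by (apply Rdiv_lt_0_compat; lra).
pose proof (exp_ineq1_le t) as Hexp.
assert (Hinv : exp t * exp (- t) = 1) by (rewrite <- exp_plus, Rplus_opp_r; apply exp_0).
pose proof (exp_pos (- t)) as Hp.
assert (Hkey : (1 + t) * exp (- t) <= 1) by (rewrite <- Hinv; apply Rmult_le_compat_r; lra).
replace (h * E) with (eps / beta * E * t) by (rewrite Hh'; ring).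
replace ((h + eps / beta) * (E - E * exp (- t)))
  with (eps / beta * E * (1 + t - (1 + t) * exp (- t))) by (rewrite Hh'; ring).
apply Rmult_le_compat_l; [nra|lra].
Qed.

(** The three summands are the three parts of [S']: the smooth part of all truncation errors, spread
    evenly over the nodes; the layer part on the fine mesh, summed by [exp_step_telescope]; and the
    transition node, entered as a jump. The decay condition is placed at [J - 1] because that is the
    left node of the stencil at [x J]; from there on the layer weight is at most 2. *)
Lemma piecewise_uniform_error (beta delta M K Rc eps h H : R) (N J : nat)
  (x W : nat -> R) (b b1 b2 c c1 c2 g w w1 w2 : R -> R) :
  coef_bounds beta delta M b b1 b2 c c1 c2 ->
  layer_problem M eps b c g w w1 w2 ->
  0 <= K -> layer_bounded K beta eps w w1 w2 -> 1 <= Rc ->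
  (1 <= J)%nat -> (J < N)%nat ->
  0 < h -> h <= H -> h * INR N <= 1 -> H * INR N <= Rc -> M * H <= beta / 4 ->
  (forall n, (n < J)%nat -> x (S n) = x n + h) ->
  (forall n, (J <= n)%nat -> (n < N)%nat -> x (S n) = x n + H) ->
  x 0%nat = 0 -> x N = 1 ->
  exp (- beta * x (J - 1)%nat / eps) <= eps * eps ->
  W 0%nat = w 0 -> W N = 0 ->
  (forall n, (S n < N)%nat -> LN eps b c x W (S n) = eps * g (x (S n))) ->
  forall i, (i <= N)%nat ->
  Rabs (w (x i) - W i) <= 4 / beta *
    ((6 * (M * K) + M * (M * K) + M + (M + 6 * (M * K)) * (Rc * Rc)) * (h * h + eps / INR N)
     + (6 * (M * K) + M * (M * K)) * (h * h / (eps * eps) * (h + eps / beta))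
     + (4 * K + 4 * (M * K) + M) * Rc * (eps / INR N)).
Proof.
intros CB LP HK HB HR HJ HJN Hh HhH HhN HHN HMH Hfine Hcoarse X0 XN Htail W0 WN HW.
pose proof (lp_eps _ _ _ _ _ _ _ _ LP) as He.
pose proof (cb_beta _ _ _ _ _ _ _ _ _ CB) as Hbeta.
pose proof (cb_delta _ _ _ _ _ _ _ _ _ CB) as Hdel.
pose proof (cb_M _ _ _ _ _ _ _ _ _ CB) as HM.
set (C2 := 6 * (M * K) + M * (M * K)).
set (C1 := C2 + M + (M + 6 * (M * K)) * (Rc * Rc)).
set (C3 := (4 * K + 4 * (M * K) + M) * Rc).
set (D := h * h / (eps * eps) * (h + eps / beta)).
assert (HN : 0 < INR N) by (apply lt_0_INR; lia).
set (nu := / INR N).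
assert (Hnu : 0 < nu) by now apply Rinv_0_lt_compat.
change (eps / INR N) with (eps * nu).
assert (Hhnu : h <= nu).
{ apply Rmult_le_reg_r with (INR N); [lra|]. unfold nu. rewrite Rinv_l; lra. }
assert (HHnu : H <= Rc * nu).
{ apply Rmult_le_reg_r with (INR N); [lra|]. unfold nu. rewrite Rmult_assoc, Rinv_l; lra. }
assert (HMK : 0 <= M * K) by (apply Rmult_le_pos; lra).
assert (HC2 : 0 <= C2) by (unfold C2; nra).
assert (HMR : 0 <= (M + 6 * (M * K)) * (Rc * Rc)) by (apply Rmult_le_pos; nra).
assert (HC1 : 0 <= C1) by (unfold C1; lra).
assert (HC3 : 0 <= C3) by (unfold C3; apply Rmult_le_pos; lra).
assert (HD : 0 <= D).
{ unfold D. apply Rmult_le_pos; [apply Rdiv_le_0_compat; nra|].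
  apply Rplus_le_le_0_compat; [lra|apply Rdiv_le_0_compat; lra]. }
assert (Hstep : forall n, (n < N)%nat -> x (S n) = x n + h /\ (n < J)%nat \/ x (S n) = x n + H /\ (J <= n)%nat).
{ intros n Hn. destruct (Compare_dec.le_lt_dec J n) as [L|L]; [right|left]; split; auto. }
assert (Hinc : forall n, (n < N)%nat -> x n < x (S n)).
{ intros n Hn. destruct (Hstep n Hn) as [[E _]|[E _]]; lra. }
assert (Hrange : forall i, (i <= N)%nat -> 0 <= x i <= 1).
{ intros i Hi. rewrite <- X0 at 1. rewrite <- XN.
  split; apply (nondecreasing_steps x N); trivial; lia. }
assert (Hweight : forall n, (J - 1 <= n)%nat -> (n <= N)%nat -> layer_weight beta eps (x n) <= 2).
{ intros n Hn HnN. unfold layer_weight.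
  assert (exp (- beta * x n / eps) <= eps * eps).
  { apply Rle_trans with (2 := Htail). apply exp_nondecreasing.
    pose proof (nondecreasing_steps x N (J - 1) n Hinc Hn HnN).
    apply Rmult_le_reg_r with eps; [lra|]. field_simplify; nra. }
  enough (exp (- beta * x n / eps) / (eps * eps) <= 1) by lra.
  apply Rmult_le_reg_r with (eps * eps); [nra|].
  unfold Rdiv at 1. rewrite Rmult_assoc, Rinv_l; nra. }
(* [S' i] dominates the weighted sum of the truncation errors at the nodes up to [x i]. *)
pose (S' := fun i : nat => C1 * (h * h + eps * nu) * (nu * INR i)
  + C2 * D * (1 - exp (- beta * x i / eps))
  + C3 * (eps * nu) * (if (J <=? i)%nat then 1 else 0)).
assert (HS0 : S' 0%nat = 0).
{ unfold S'. rewrite X0. replace (- beta * 0 / eps) with 0 by (field; lra).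
  rewrite exp_0. destruct (Nat.leb_spec J 0) as [L|L]; [lia|]. simpl. ring. }
assert (HSN : S' (N - 1)%nat <= C1 * (h * h + eps * nu) + C2 * D + C3 * (eps * nu)).
{ unfold S'. assert (A1 : nu * INR (N - 1) <= 1).
  { rewrite minus_INR by lia. simpl. unfold nu. rewrite Rmult_minus_distr_l, Rinv_l by lra.
    fold nu. lra. }
  pose proof (exp_pos (- beta * x (N - 1)%nat / eps)) as A2.
  assert (A3 : 0 <= C1 * (h * h + eps * nu)) by (apply Rmult_le_pos; nra).
  assert (A4 : 0 <= C2 * D) by (apply Rmult_le_pos; lra).
  assert (A5 : 0 <= C3 * (eps * nu)) by (apply Rmult_le_pos; nra).
  repeat apply Rplus_le_compat.
  - rewrite <- (Rmult_1_r (C1 * (h * h + eps * nu))) at 2. apply Rmult_le_compat_l; lra.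
  - rewrite <- (Rmult_1_r (C2 * D)) at 2. apply Rmult_le_compat_l; lra.
  - destruct (J <=? N - 1)%nat; lra. }
intros i Hi.
apply Rle_trans with (4 / beta * (S' (N - 1)%nat - S' 0%nat)).
2: { apply Rmult_le_compat_l; [apply Rdiv_le_0_compat; lra|]. lra. }
apply (LN_stability eps beta M b c x (fun i => w (x i) - W i) S' N); trivial; try lra; try lia.
- intros n Hn. destruct (Hstep n ltac:(lia)) as [[E1 ?]|[E1 ?]];
    destruct (Hstep (S n) Hn) as [[E2 ?]|[E2 ?]]; try lia; lra.
- intros n Hn. destruct (Hstep n Hn) as [[E _]|[E _]]; rewrite E.
  + replace (x n + h - x n) with h by ring. nra.
  + replace (x n + H - x n) with H by ring. exact HMH.
- intros n Hn. pose proof (Hrange n ltac:(lia)). pose proof (Hrange (S n) ltac:(lia)).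
  destruct (mvt_open b b1 (x n) (x (S n)) (Hinc n Hn)) as [q [Hq E]].
  + intros z Hz. apply (is_derive_continuity_pt _ _ (b1 z)), (cb_b1 _ _ _ _ _ _ _ _ _ CB); lra.
  + intros z Hz. apply (cb_b1 _ _ _ _ _ _ _ _ _ CB); lra.
  + pose proof (cb_b1_bound _ _ _ _ _ _ _ _ _ CB q ltac:(lra)) as Bq.
    apply Rabs_le_between in Bq. specialize (Hinc n Hn). nra.
- intros n Hn. pose proof (cb_b_lower _ _ _ _ _ _ _ _ _ CB (x n) (Hrange n Hn)). lra.
- intros n Hn. apply (cb_c_lower _ _ _ _ _ _ _ _ _ CB), Hrange, Hn.
- rewrite X0, W0. ring.
- rewrite XN, (lp_1 _ _ _ _ _ _ _ _ LP), WN. ring.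
- intros n Hn. rewrite (LN_minus eps b c x (fun i => w (x i)) W), HW by trivial.
  pose proof (Hrange n ltac:(lia)) as R0. pose proof (Hrange (S n) ltac:(lia)) as R1.
  pose proof (Hrange (S (S n)) ltac:(lia)) as R2.
  pose proof (Hinc n ltac:(lia)) as I0. pose proof (Hinc (S n) ltac:(lia)) as I1.
  set (E0 := exp (- beta * x n / eps)). set (E1 := exp (- beta * x (S n) / eps)).
  assert (HE10 : E1 <= E0).
  { apply exp_nondecreasing. apply Rmult_le_reg_r with eps; [lra|]. field_simplify; nra. }
  assert (HSinc : S' (S n) - S' n = C1 * (h * h + eps * nu) * nu + C2 * D * (E0 - E1)
    + C3 * (eps * nu) * ((if (J <=? S n)%nat then 1 else 0) - (if (J <=? n)%nat then 1 else 0))).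
  { unfold S'. rewrite S_INR. fold E0 E1. ring. }
  assert (A2 : 0 <= C2 * D * (E0 - E1)) by (apply Rmult_le_pos; [apply Rmult_le_pos|]; lra).
  rewrite HSinc. clear HSinc.
  destruct (Hstep n ltac:(lia)) as [[S0 L0]|[S0 L0]];
    destruct (Hstep (S n) Hn) as [[S1 L1]|[S1 L1]]; try lia.
  + rewrite (LN_uniform eps h b c w x n) by trivial.
    pose proof (truncation_second_order beta delta M K eps (x (S n)) h
      b b1 b2 c c1 c2 g w w1 w2 CB LP HK HB Hh ltac:(lra) ltac:(lra)) as T.
    fold C2 in T. replace (x (S n) - h) with (x n) in T by lra.
    unfold layer_weight in T. fold E0 in T.
    replace (x (S n) - h) with (x n) by lra.
    replace ((x (S (S n)) - x n) / 2) with h by lra.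
    assert (HT : h * E0 <= (h + eps / beta) * (E0 - E1)).
    { unfold E0, E1. rewrite S0. apply exp_step_telescope; lra. }
    assert (HT2 : C2 * (h * h / (eps * eps)) * (h * E0) <= C2 * D * (E0 - E1)).
    { replace (C2 * D * (E0 - E1))
        with (C2 * (h * h / (eps * eps)) * ((h + eps / beta) * (E0 - E1))) by (unfold D; ring).
      apply Rmult_le_compat_l; [|exact HT].
      apply Rmult_le_pos; [lra|apply Rdiv_le_0_compat; nra]. }
    apply Rmult_le_compat_l with (r := h) in T; [|lra].
    eapply Rle_trans; [exact T|].
    replace (h * (C2 * (h * h * (1 + E0 / (eps * eps))) + M * (eps * h)))
      with (C2 * (h * h) * h + C2 * (h * h / (eps * eps)) * (h * E0) + M * eps * (h * h)) by (field; lra).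
    assert (B1 : C2 * (h * h) * h <= C2 * (h * h) * nu) by (apply Rmult_le_compat_l; nra).
    assert (B2 : M * eps * (h * h) <= M * eps * (nu * nu)) by (apply Rmult_le_compat_l; nra).
    assert (B3 : C2 * (h * h) * nu + M * eps * (nu * nu) <= C1 * (h * h + eps * nu) * nu).
    { assert (0 <= (M + (M + 6 * (M * K)) * (Rc * Rc)) * (h * h * nu)) by (apply Rmult_le_pos; nra).
      assert (0 <= (C2 + (M + 6 * (M * K)) * (Rc * Rc)) * (eps * nu * nu)) by (apply Rmult_le_pos; nra).
      unfold C1. lra. }
    destruct (Nat.leb_spec J (S n)); [lia|]. destruct (Nat.leb_spec J n); [lia|]. lra.
  + (* The stencil at [x J] is not uniform, but a single node with consistency error
       [O(eps)] contributes only [O(eps / N)] to the l^1 norm. *)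
    pose proof (truncation_crude beta delta M K eps x n b b1 b2 c c1 c2 g w w1 w2
      CB LP HK HB ltac:(lra) I0 I1 ltac:(lra)) as T.
    pose proof (Hweight n ltac:(lia) ltac:(lia)) as Wn.
    assert (T' : Rabs (LN eps b c x (fun i => w (x i)) (S n) - eps * g (x (S n)))
       <= (4 * K + 4 * (M * K) + M) * eps).
    { apply Rle_trans with (1 := T). apply Rmult_le_compat_r; [lra|].
      assert (K * layer_weight beta eps (x n) <= K * 2) by (apply Rmult_le_compat_l; lra).
      assert (M * (K * layer_weight beta eps (x n)) <= M * (K * 2)) by (apply Rmult_le_compat_l; lra).
      lra. }
    assert (Hhb : 0 <= (x (S (S n)) - x n) / 2 <= Rc * nu) by lra.
    assert (B1 : (x (S (S n)) - x n) / 2 * Rabs (LN eps b c x (fun i => w (x i)) (S n) - eps * g (x (S n)))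
      <= Rc * nu * ((4 * K + 4 * (M * K) + M) * eps)).
    { apply Rmult_le_compat; try lra. apply Rabs_pos. }
    destruct (Nat.leb_spec J (S n)); [|lia]. destruct (Nat.leb_spec J n); [lia|].
    assert (0 <= C1 * (h * h + eps * nu) * nu) by (apply Rmult_le_pos; [apply Rmult_le_pos|]; nra).
    unfold C3. lra.
  + rewrite (LN_uniform eps H b c w x n) by (trivial; lra).
    pose proof (truncation_first_order beta delta M K eps (x (S n)) H
      b b1 b2 c c1 c2 g w w1 w2 CB LP HK HB ltac:(lra) ltac:(lra) ltac:(lra)) as T.
    replace (x (S n) - H) with (x n) in T by lra.
    replace (x (S n) - H) with (x n) by lra.
    replace ((x (S (S n)) - x n) / 2) with H by lra.
    pose proof (Hweight n ltac:(lia) ltac:(lia)) as Wn.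
    assert (T' : (M + 3 * (M * (K * layer_weight beta eps (x n)))) * (eps * H)
       <= (M + 6 * (M * K)) * (eps * H)).
    { apply Rmult_le_compat_r; [nra|].
      assert (M * K * layer_weight beta eps (x n) <= M * K * 2) by (apply Rmult_le_compat_l; lra).
      lra. }

    pose proof (Rle_trans _ _ _ T T') as T2.
    apply Rmult_le_compat_l with (r := H) in T2; [|lra].
    eapply Rle_trans; [exact T2|].
    assert (HH2 : H * H <= Rc * nu * (Rc * nu)) by (apply Rmult_le_compat; lra).
    assert (B1 : (M + 6 * (M * K)) * eps * (H * H) <= (M + 6 * (M * K)) * eps * (Rc * nu * (Rc * nu))).
    { apply Rmult_le_compat_l; [nra|exact HH2]. }
    assert (B2 : 0 <= (C2 + M) * (eps * nu * nu)) by (apply Rmult_le_pos; [lra|repeat apply Rmult_le_pos; lra]).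
    assert (B3 : 0 <= C1 * (h * h) * nu) by (apply Rmult_le_pos; [apply Rmult_le_pos|]; nra).
    destruct (Nat.leb_spec J (S n)); [|lia]. destruct (Nat.leb_spec J n); [|lia].
    unfold C1 in *. lra.
Qed.

(** * The A-mesh and the final estimate *)

Lemma mesh_pt_fine (N J n : nat) (xi : R) :
  (n < J)%nat -> mesh_pt N J xi (S n) = mesh_pt N J xi n + xi / INR J.
Proof.
intros Hn. unfold mesh_pt.
destruct (Nat.leb_spec (S n) J); [|lia]. destruct (Nat.leb_spec n J); [|lia].
rewrite S_INR. ring.
Qed.

Lemma mesh_pt_coarse (N J n : nat) (xi : R) :
  (1 <= J)%nat -> (J <= n)%nat ->
  mesh_pt N J xi (S n) = mesh_pt N J xi n + (1 - xi) / INR (N - J).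
Proof.
intros HJ Hn. unfold mesh_pt.
destruct (Nat.leb_spec (S n) J); [lia|]. destruct (Nat.leb_spec n J).
(* At [n = J] the definition is still in its fine branch, whose value [J * (xi / J)] is [xi] because
   [J] is not 0. *)
- replace n with J by lia. replace (S J - J)%nat with 1%nat by lia. simpl.
  set (H' := (1 - xi) / INR (N - J)). field. apply not_0_INR. lia.
- replace (S n - J)%nat with (S (n - J)) by lia. rewrite S_INR. ring.
Qed.

Theorem theorem5 :
  forall (b c f : R -> R) (beta a Q : R),
    C4_01 b -> C4_01 c -> C4_01 f ->
    0 < beta -> (forall x, 0 <= x <= 1 -> beta < b x) ->
    (forall x, 0 <= x <= 1 -> 0 <= c x) ->
    3 < a ->
    0 < Q < 1 -> (exists p q : nat, (0 < q)%nat /\ Q = INR p / INR q) ->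
  exists (N0 : nat) (C : R),
    forall (eps : R) (N J : nat) (u u0 : R -> R) (W : nat -> R),
      0 < eps < 1 ->
      (N0 <= N)%nat ->
      INR J = Q * INR N ->
      xi_tr a eps beta (/ eps) <= Q ->
      is_sol_u eps b c f u ->
      is_sol_u0 b c f u0 ->
      is_disc_sol eps b c u0 N (mesh_pt N J (xi_tr a eps beta (/ eps)))
        W ->
      forall i : nat, (i <= N)%nat ->
        let xi := mesh_pt N J (xi_tr a eps beta (/ eps)) i in
        Rabs ((u xi - u0 xi) - W i)
          <= C * Rmax (eps * Rabs (ln eps) ^ 3 / INR N ^ 2) (eps / INR N).
Proof.
intros b c f beta a Q Hb Hc Hf Hbeta Hlow Hc0 Ha HQ _.
destruct (C4_01_coef_bounds b c beta Hb Hc Hbeta Hlow Hc0) as [delta [M1 CB1]].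
destruct (C4_01_bounds f Hf) as [Mf Bf].
set (M2 := Rmax M1 Mf).
pose proof (Rmax_l M1 Mf : M1 <= M2) as L1. pose proof (Rmax_r M1 Mf : Mf <= M2) as L2.
pose proof (coef_bounds_weaken _ _ _ M2 _ _ _ _ _ _ L1 CB1) as CB2.
destruct (reduced_solution_bounds beta delta M2 _ _ _ _ _ _ f CB2) as [Ku HKu].
{ intros x Hx. destruct (Bf x Hx) as (? & ? & ? & ? & ?). split; [|split; [|split; [|split]]]; trivial; lra. }
set (M := Rmax M2 Ku).
pose proof (Rmax_l M2 Ku : M2 <= M) as L3. pose proof (Rmax_r M2 Ku : Ku <= M) as L4.
pose proof (coef_bounds_weaken _ _ _ M _ _ _ _ _ _ L3 CB2) as CB.
pose proof (cb_delta _ _ _ _ _ _ _ _ _ CB) as Hdel.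
pose proof (cb_M _ _ _ _ _ _ _ _ _ CB) as HM.
destruct (layer_bounds beta delta M Hbeta Hdel HM) as [K [HK HB]].
(* [H * N] equals [(1 - xi) / (1 - Q)], so [Rc] bounds it. *)
set (Rc := / (1 - Q)).
assert (HRc : 1 <= Rc) by (unfold Rc; rewrite <- Rinv_1; apply Rinv_le_contravar; lra).
(* Chosen so that [h = k * (eps * L) / N], see [Ehk]. *)
set (k := a / (beta * Q)).
assert (Hk : 0 < k) by (apply Rdiv_lt_0_compat; [|apply Rmult_lt_0_compat]; lra).
set (C2 := 6 * (M * K) + M * (M * K)).
set (C1 := C2 + M + (M + 6 * (M * K)) * (Rc * Rc)).
set (C3 := (4 * K + 4 * (M * K) + M) * Rc).
(* The first summand forces [J > 3], and the second makes the coarse step satisfy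
   [M * H <= beta / 4], as stability requires. *)
destruct (INR_unbounded (3 / Q + 4 * M * Rc / beta)) as [N0 HN0].
exists N0, (4 / beta * (C1 * (k * k + 1) + C2 * (k * k * k + k * k / beta) + C3)).
intros eps N J u u0 W He HN HJ Hxi Hu Hu0 HW i Hi. cbv zeta.
set (L := ln (/ eps)).
assert (HL : 0 < L).
{ unfold L. rewrite <- ln_1. apply ln_increasing; [lra|].
  rewrite <- Rinv_1. apply Rinv_lt_contravar; lra. }
assert (HLabs : Rabs (ln eps) = L).
{ unfold L. rewrite ln_Rinv by lra. apply Rabs_left.
  unfold L in HL. rewrite ln_Rinv in HL by lra. lra. }
set (xi := xi_tr a eps beta (/ eps)) in *.
assert (Exi : xi = a * eps * L / beta) by (unfold xi, xi_tr, L; field; lra).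
assert (Hxi0 : 0 < xi).
{ rewrite Exi. apply Rdiv_lt_0_compat; [|lra]. repeat apply Rmult_lt_0_compat; lra. }
assert (HNr : 3 / Q + 4 * M * Rc / beta < INR N).
{ apply Rlt_le_trans with (1 := HN0). now apply le_INR. }
assert (H3Q : 0 < 3 / Q) by (apply Rdiv_lt_0_compat; lra).
assert (HMR : 0 < 4 * M * Rc / beta) by (apply Rdiv_lt_0_compat; [apply Rmult_lt_0_compat|]; lra).
assert (HNpos : 0 < INR N) by lra.
assert (HJ3r : 3 < INR J).
{ rewrite HJ. replace 3 with (Q * (3 / Q)) by (field; lra). apply Rmult_lt_compat_l; lra. }
assert (HJ3 : (3 <= J)%nat) by (apply INR_le; simpl; lra).
assert (HJN : (J < N)%nat) by (apply INR_lt; rewrite HJ; nra).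
assert (HNJ : INR (N - J) = (1 - Q) * INR N) by (rewrite minus_INR by lia; rewrite HJ; ring).
set (h := xi / INR J). set (H := (1 - xi) / INR (N - J)).
assert (Eh : h * INR N = xi / Q) by (unfold h; rewrite HJ; field; lra).
assert (EH : H * INR N = (1 - xi) * Rc) by (unfold H, Rc; rewrite HNJ; field; lra).
assert (Hh : 0 < h) by (apply Rdiv_lt_0_compat; lra).
assert (HhN : h * INR N <= 1).
{ rewrite Eh. apply Rmult_le_reg_r with Q; [lra|]. field_simplify; lra. }
assert (HHN : 1 <= H * INR N <= Rc).
{ rewrite EH. split; [|nra]. unfold Rc. apply Rmult_le_reg_r with (1 - Q); [lra|].
  rewrite Rmult_assoc, Rinv_l; lra. }
(* Both steps are compared with [1 / N]: the assumption [xi <= Q] gives [h * N <= 1 <= H * N]. *)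
assert (HhH : h <= H) by (apply Rmult_le_reg_r with (INR N); lra).
assert (HMH : M * H <= beta / 4).
{ apply Rmult_le_reg_r with (INR N); [lra|].
  apply Rle_trans with (M * Rc); [nra|].
  replace (M * Rc) with (beta / 4 * (4 * M * Rc / beta)) by (field; lra).
  apply Rmult_le_compat_l; lra. }
set (x := mesh_pt N J xi) in *.
assert (X0 : x 0%nat = 0) by (unfold x, mesh_pt; simpl; ring).
assert (XN : x N = 1).
{ unfold x, mesh_pt. destruct (Nat.leb_spec N J); [lia|].
  field. rewrite HNJ. nra. }
assert (Hfine : forall n, (n < J)%nat -> x (S n) = x n + h) by (intros n Hn; now apply mesh_pt_fine).
assert (Hcoarse : forall n, (J <= n)%nat -> (n < N)%nat -> x (S n) = x n + H)
  by (intros n Hn _; apply mesh_pt_coarse; lia).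
assert (Htail : exp (- beta * x (J - 1)%nat / eps) <= eps * eps).
{ (* [J >= 3] and [a > 3] give [a (1 - 1/J) >= 2]. *)
  replace (eps * eps) with (exp (- (2 * L))).
  2: { unfold L. rewrite ln_Rinv by lra. replace (- (2 * - ln eps)) with (ln eps + ln eps) by ring.
       rewrite exp_plus, exp_ln; lra. }
  apply exp_nondecreasing.
  unfold x, mesh_pt. destruct (Nat.leb_spec (J - 1) J); [|lia].
  rewrite minus_INR by lia. simpl INR. rewrite Exi.
  replace (- beta * ((INR J - 1) * (a * eps * L / beta / INR J)) / eps)
    with (- (a * L * (1 - / INR J))) by (field; lra).
  assert (/ INR J <= / 3) by (apply Rinv_le_contravar; lra).
  assert (2 <= a * (1 - / INR J)) by nra.
  assert (2 * L <= a * (1 - / INR J) * L) by (apply Rmult_le_compat_r; lra).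
  lra. }
destruct (HKu u0 Hu0) as (U0 & D2 & B2 & Lip).
assert (LP : layer_problem M eps b c (Derive (Derive u0))
    (fun t => u (clamp t) - u0 (clamp t))
    (fun t => Derive u t - Derive u0 t)
    (fun t => Derive (Derive u) t - Derive (Derive u0) t)).
{ apply (layer_problem_of_solutions M eps b c f u u0); trivial; try lra.
  - intros y Hy. specialize (B2 y Hy). lra.
  - intros y z Hy Hz. apply Rle_trans with (1 := Lip y z Hy Hz).
    apply Rmult_le_compat_r; [apply Rabs_pos|lra]. }
destruct HW as (HW0 & HWN & HW).
destruct Hu as (_ & Hu00 & Hu01 & _).
assert (Hmono : forall n, (n < N)%nat -> x n < x (S n)).
{ intros n Hn. destruct (Compare_dec.le_lt_dec J n); [rewrite Hcoarse by trivial|rewrite Hfine by trivial]; lra. }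
pose proof (piecewise_uniform_error beta delta M K Rc eps h H N J x W b _ _ c _ _ _ _ _ _
  CB LP ltac:(lra) (HB _ _ _ _ _ _ _ _ _ _ _ CB LP) HRc ltac:(lia) HJN Hh HhH HhN (proj2 HHN) HMH
  Hfine Hcoarse X0 XN Htail) as Main.
specialize (Main ltac:(cbv beta; rewrite clamp_id by lra; rewrite HW0; lra) HWN).
specialize (Main ltac:(intros n Hn; apply HW; lia) i Hi).
cbv beta in Main.
rewrite clamp_id in Main.
2: { rewrite <- X0 at 1. rewrite <- XN. split; apply (nondecreasing_steps x N); trivial; lia. }
apply Rle_trans with (1 := Main).
fold C2. fold C1. fold C3.
rewrite (Rmult_assoc (4 / beta)).
apply Rmult_le_compat_l; [apply Rdiv_le_0_compat; lra|].
rewrite HLabs.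
set (X := Rmax (eps * L ^ 3 / INR N ^ 2) (eps / INR N)).
assert (X1 : eps * L ^ 3 / INR N ^ 2 <= X) by apply Rmax_l.
assert (X2 : eps / INR N <= X) by apply Rmax_r.
assert (HN1 : 1 <= INR N) by (change 1 with (INR 1); apply le_INR; lia).
(* For [L >= 1] the square is at most the cube; for [L < 1] it is at most 1, and [eps / N]
   dominates. *)
assert (X3 : eps * L ^ 2 / INR N ^ 2 <= X).
{ destruct (Rle_dec 1 L) as [HL1|HL1].
  - apply Rle_trans with (2 := X1). apply Rmult_le_compat_r.
    + left; apply Rinv_0_lt_compat; nra.
    + apply Rmult_le_compat_l; [lra|]. simpl. nra.
  - apply Rle_trans with (2 := X2).
    apply Rmult_le_reg_r with (INR N ^ 2); [nra|].
    replace (eps * L ^ 2 / INR N ^ 2 * INR N ^ 2) with (eps * L ^ 2) by (field; lra).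
    replace (eps / INR N * INR N ^ 2) with (eps * INR N) by (field; lra).
    apply Rmult_le_compat_l; [lra|]. simpl. nra. }
assert (HX : 0 <= X) by (apply Rle_trans with (2 := X2); apply Rdiv_le_0_compat; lra).
assert (Ehk : h = k * (eps * L) / INR N).
{ unfold h, k. rewrite HJ, Exi. field. lra. }
assert (Hhh : h * h <= k * k * X).
{ replace (h * h) with (k * k * (eps * (eps * L ^ 2 / INR N ^ 2))) by (rewrite Ehk; field; lra).
  apply Rmult_le_compat_l; [nra|].
  assert (0 <= eps * L ^ 2 / INR N ^ 2) by (apply Rdiv_le_0_compat;
    [apply Rmult_le_pos; [lra|apply pow_le; lra]|apply pow_lt; lra]). nra. }
(* Here [h / eps] is [k L / N], so every negative power of [eps] disappears. The cubic term comes
   with [1 / N^3], one factor [1 / N] better than needed. *)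
assert (Hh3 : h * h / (eps * eps) * (h + eps / beta) <= (k * k * k + k * k / beta) * X).
{ replace (h * h / (eps * eps) * (h + eps / beta))
    with (k * k * k * (eps * L ^ 3 / INR N ^ 2 / INR N) + k * k / beta * (eps * L ^ 2 / INR N ^ 2))
    by (rewrite Ehk; field; lra).
  rewrite Rmult_plus_distr_r. apply Rplus_le_compat; apply Rmult_le_compat_l; trivial.
  - apply Rmult_le_pos; [apply Rmult_le_pos|]; lra.
  - apply Rle_trans with (2 := X1).
    apply Rmult_le_reg_r with (INR N); [lra|].
    unfold Rdiv at 1. rewrite Rmult_assoc, Rinv_l by lra.
    apply Rmult_le_compat_l; [|lra]. apply Rdiv_le_0_compat; [|nra].
    apply Rmult_le_pos; [lra|]. apply pow_le; lra.
  - apply Rdiv_le_0_compat; nra. }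
assert (HMK : 0 <= M * K) by nra.
assert (HC2 : 0 <= C2) by (unfold C2; nra).
assert (HC1 : 0 <= C1) by (unfold C1; assert (0 <= (M + 6 * (M * K)) * (Rc * Rc)) by (apply Rmult_le_pos; nra); lra).
assert (HC3 : 0 <= C3) by (unfold C3; apply Rmult_le_pos; lra).
rewrite !Rmult_plus_distr_r. rewrite !(Rmult_assoc _ _ X).
repeat apply Rplus_le_compat; apply Rmult_le_compat_l; trivial; lra.
Qed.
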